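(* Let $\ell=2n$ with $n\in\mathbb Z_{\ge2}$, and let $j=n$ (so $\omega(j)=n+1$). Let $\widehat P\in\widehat{\mathcal{MV}}$ and $P=\Phi^{-1}(\widehat P)\in\mathcal{MV}^\omega$. Let $\mu_\bullet=(\mu_w)_{w\in W}$ and $\mu'_\bullet=(\mu'_w)_{w\in W}$ be the GGMS data of $P$ and of $f_n^\omega P$, respectively, let $c=M_{\Lambda_n}-M_{s_n\Lambda_n}-1$ where $(M_\gamma)_{\gamma\in\Gamma}=D(\mu_\bullet)$, and put $\sigma(h)=s_j\cdot h+ch_j$, $\tau(h)=s_{\omega(j)}\cdot h+ch_{\omega(j)}$ for $h\in\mathfrak h$. Then $\widetilde P(\mu'_\bullet)$ is the smallest convex polytope (with respect to inclusion) among the polytopes $\widetilde P=\widetilde P(\mu''_\bullet)\in\widetilde{\mathcal P}$ with GGMS datum $\mu''_\bullet=(\mu''_w)_{w\in W}\in\mathcal V^\omega$ satisfying the following conditions (i)–(v) (that is, $\widetilde P(\mu'_\bullet)$ itself satisfies them with $\mu''_\bullet=\mu'_\bullet$, and it is contained in every such $\widetilde P$): (i) If $w\in W^\omega_-$, then $\mu''_w=\mu_w$. (ii) $\mu''_e=\mu_e-h_n^\omega$. (iii) If $w\in W^\omega_+$, then $\mu_w\in\widetilde P$. (iv) If $w\in W$ is such that $s_jw<w$ and $\langle\alpha_j,\mu_w\rangle\ge c$, then $\sigma(\mu_w)\in\widetilde P$. Also, if $w\in W$ is such that $s_{\omega(j)}w<w$ and $\langle\alpha_{\omega(j)},\mu_w\rangle\ge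 c$, then $\tau(\mu_w)\in\widetilde P$. (v) If $w\in W^\omega_-$ is such that $\langle\alpha_j,\mu_w\rangle\ge c$, then $\sigma\tau\sigma(\mu_w)\in\widetilde P$.
   Context: **Type $A$ data.** Let $\ell=2n$ with $n\ge2$, $I=\{1,\dots,\ell\}$, and let $\mathfrak g$ be the simple Lie algebra over $\mathbb C$ of type $A_\ell$ with Cartan subalgebra $\mathfrak h$, simple coroots $h_j\in\mathfrak h$, simple roots $\alpha_j\in\mathfrak h^*$, fundamental weights $\Lambda_j\in\mathfrak h^*$ ($j\in I$), Cartan matrix $a_{ij}=\langle\alpha_j,h_i\rangle$, and Weyl group $W=\langle s_i\mid i\in I\rangle$ with unit $e$ and longest element $w_0$; $>$ is the (weak) Bruhat order ($ws_i>w$ iff right multiplication by $s_i$ raises the length; similarly on the left). Put $\mathfrak h_{\mathbb R}=\bigoplus_j\mathbb R h_j$ and $\Gamma=\{w\Lambda_i\mid w\in W,i\in I\}$. For $w\in W$ and $h,h'\in\mathfrak h_{\mathbb R}$ write $h\ge_w h'$ if $w^{-1}h-w^{-1}h'\in\sum_j\mathbb R_{\ge0}h_j$. **Pseudo-Weyl and MV polytopes.** $\mathcal V$ is the set of families $\mu_\bullet=(\mu_w)_{w\in W}$ in $\mathfrak h_{\mathbb R}$ with $\mu_{w'}\ge_w\mu_w$ for all $w,w'\in W$ and $\mu_{w_0}=0$. For $\mu_\bullet\in\mathcal V$ let $P(\mu_\bullet)=\{h\in\mathfrak h_{\mathbb R}\mid h\ge_w\mu_w\ \forall w\in W\}$;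 it determines $\mu_\bullet$, called its GGMS datum. Put $D(\mu_\bullet)=(M_\gamma)_{\gamma\in\Gamma}$ with $M_{w\Lambda_i}=\langle w\Lambda_i,\mu_w\rangle$ (well defined). $P(\mu_\bullet)$ is an MV polytope for $\mathfrak g$ if all $M_\gamma\in\mathbb Z$ and, for all $w\in W$ and $i\ne j$ in $I$ with $ws_i>w$, $ws_j>w$, $a_{ij}=a_{ji}=-1$, $$M_{ws_i\Lambda_i}+M_{ws_j\Lambda_j}=\min\bigl(M_{w\Lambda_i}+M_{ws_is_j\Lambda_j},\ M_{ws_js_i\Lambda_i}+M_{w\Lambda_j}\bigr).$$ $\mathcal{MV}$ is the set of MV polytopes for $\mathfrak g$. **Kashiwara operators on $\mathcal{MV}$.** For $j\in I$ and $P=P(\mu_\bullet)\in\mathcal{MV}$, $f_jP$ is the unique MV polytope $P(\mu'_\bullet)\in\mathcal{MV}$ with $\mu'_e=\mu_e-h_j$ and $\mu'_w=\mu_w$ for all $w\in W$ with $s_jw<w$ (existence and uniqueness are known, due to Kamnitzer). **Diagram automorphism.** $\omega:I\to I$, $\omega(j)=\ell-j+1$; $\omega$ also denotes the induced involutions of $\mathfrak g$ (permuting the Chevalley generators), of $\mathfrak h$ ($h_j\mapsto h_{\omega(j)}$) and of $W$ ($s_i\mapsto s_{\omega(i)}$); $\mathfrak g^\omega,\mathfrak h^\omega,W^\omega$ are the fixed points. For $\mu_\bullet\in\mathcal V$, $\omega(\mu_\bullet)=(\omega(\mu_{\omega(w)}))_{w\in W}\in\mathcal V$; $\mathcal V^\omega=\{\mu_\bullet\in\mathcal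 V\mid\omega(\mu_\bullet)=\mu_\bullet\}$. $\mathcal{MV}^\omega$ is the set of $P(\mu_\bullet)\in\mathcal{MV}$ with $\mu_\bullet\in\mathcal V^\omega$, equivalently with $\omega(P)=P$. **Operators $f_j^\omega$, elements $s_j^\omega$, $h_j^\omega$** ($j\in\widehat I=\{1,\dots,n\}$). For $1\le j\le n-1$: $f_j^\omega=f_jf_{\omega(j)}$, $s_j^\omega=s_js_{\omega(j)}$, $h_j^\omega=h_j+h_{\omega(j)}$. For $j=n$ (here $\ell=2n$): $f_n^\omega=f_nf_{\omega(n)}^2f_n$, $s_n^\omega=s_ns_{\omega(n)}s_n$, $h_n^\omega=2(h_n+h_{\omega(n)})$. The operators $f_j^\omega$ preserve $\mathcal{MV}^\omega$. With $j=n$, $W^\omega_+=\{w\in W^\omega\mid s_n^\omega w>w\}$ and $W^\omega_-=\{w\in W^\omega\mid s_n^\omega w<w\}$. **Polytopes $\widetilde P$.** For $\mu_\bullet\in\mathcal V^\omega$, $\widetilde P(\mu_\bullet)=\{h\in\mathfrak h_{\mathbb R}\mid h\ge_w\mu_w\text{ for all }w\in W^\omega\}$, a convex polytope in $\mathfrak h_{\mathbb R}$; $\mu_\bullet$ is called its GGMS datum. $\widetilde{\mathcal P}=\{\widetilde P(\mu_\bullet)\mid\mu_\bullet\in\mathcal V^\omega\}$. **The fixed point algebra and $\widehat{\mathcal{MV}}$.** $\mathfrak g^\omega$ is simple of type $B_n$ with Cartan subalgebra $\mathfrak h^\omega$ and simple coroots $h_j^\omega$, $j\in\widehat I$. Let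 $\widehat A=(\widehat a_{ij})$ be its Cartan matrix ($\widehat a_{ij}$ is the value of the $j$-th simple root on $h_i^\omega$), $\widehat\Lambda_i\in(\mathfrak h^\omega)^*$ its fundamental weights, $\widehat W=\langle\widehat s_i\mid i\in\widehat I\rangle$ its Weyl group with unit $\widehat e$ and longest element $\widehat w_0$. There is a group isomorphism $\Theta:\widehat W\to W^\omega$ with $\Theta(\widehat s_i)=s_i^\omega$. On $\mathfrak h^\omega\cap\mathfrak h_{\mathbb R}$, $h\ge_{\widehat w}h'$ means $\widehat w^{-1}h-\widehat w^{-1}h'\in\sum_{j\in\widehat I}\mathbb R_{\ge0}h_j^\omega$. $\widehat{\mathcal V}$ is the set of families $(\widehat\mu_{\widehat w})_{\widehat w\in\widehat W}$ in $\mathfrak h^\omega\cap\mathfrak h_{\mathbb R}$ with $\widehat\mu_{\widehat w'}\ge_{\widehat w}\widehat\mu_{\widehat w}$ for all $\widehat w,\widehat w'$ and $\widehat\mu_{\widehat w_0}=0$; $\widehat P(\widehat\mu_\bullet)=\{h\in\mathfrak h^\omega\cap\mathfrak h_{\mathbb R}\mid h\ge_{\widehat w}\widehat\mu_{\widehat w}\ \forall\widehat w\}$; $\widehat M_{\widehat w\widehat\Lambda_i}=\langle\widehat w\widehat\Lambda_i,\widehat\mu_{\widehat w}\rangle$. $\widehat P(\widehat\mu_\bullet)$ is an MV polytope for $\mathfrak g^\omega$ (an element of $\widehat{\mathcal{MV}}$) if all $\widehat M_{\widehat\gamma}\in\mathbb Z$ and, for all $w\in\widehat W$ and $i\ne j$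 in $\widehat I$ with $w\widehat s_i>w$, $w\widehat s_j>w$ (writing $s,\Lambda,M,a$ for $\widehat s,\widehat\Lambda,\widehat M,\widehat a$), either $a_{ij}=a_{ji}=0$, or (1) $a_{ij}=a_{ji}=-1$ and $M_{ws_i\Lambda_i}+M_{ws_j\Lambda_j}=\min(M_{w\Lambda_i}+M_{ws_is_j\Lambda_j},\ M_{ws_js_i\Lambda_i}+M_{w\Lambda_j})$; or (2) $a_{ij}=-1,a_{ji}=-2$ and $M_{ws_j\Lambda_j}+M_{ws_is_j\Lambda_j}+M_{ws_i\Lambda_i}=\min(2M_{ws_is_j\Lambda_j}+M_{w\Lambda_i},\ 2M_{w\Lambda_j}+M_{ws_is_js_i\Lambda_i},\ M_{w\Lambda_j}+M_{ws_js_is_j\Lambda_j}+M_{ws_i\Lambda_i})$, $M_{ws_js_i\Lambda_i}+2M_{ws_is_j\Lambda_j}+M_{ws_i\Lambda_i}=\min(2M_{w\Lambda_j}+2M_{ws_is_js_i\Lambda_i},\ 2M_{ws_js_is_j\Lambda_j}+2M_{ws_i\Lambda_i},\ M_{ws_is_js_i\Lambda_i}+2M_{ws_is_j\Lambda_j}+M_{w\Lambda_i})$; or (3) $a_{ij}=-2,a_{ji}=-1$ and $M_{ws_js_i\Lambda_i}+M_{ws_i\Lambda_i}+M_{ws_is_j\Lambda_j}=\min(2M_{ws_i\Lambda_i}+M_{ws_js_is_j\Lambda_j},\ 2M_{ws_is_js_i\Lambda_i}+M_{w\Lambda_j},\ M_{ws_is_js_i\Lambda_i}+M_{w\Lambda_i}+M_{ws_is_j\Lambda_j})$,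 $M_{ws_j\Lambda_j}+2M_{ws_i\Lambda_i}+M_{ws_is_j\Lambda_j}=\min(2M_{ws_is_js_i\Lambda_i}+2M_{w\Lambda_j},\ 2M_{w\Lambda_i}+2M_{ws_is_j\Lambda_j},\ M_{w\Lambda_j}+2M_{ws_i\Lambda_i}+M_{ws_js_is_j\Lambda_j})$. **The map $\Phi$.** $\Phi:\mathcal{MV}^\omega\to\widehat{\mathcal{MV}}$, $\Phi(P(\mu_\bullet))=\widehat P\bigl((\mu_{\Theta(\widehat w)})_{\widehat w\in\widehat W}\bigr)$, is a bijection. With $\widehat f_j$ the lowering Kashiwara operator on $\widehat{\mathcal{MV}}$ (characterized by $\widehat\mu'_{\widehat e}=\widehat\mu_{\widehat e}-h_j^\omega$ and $\widehat\mu'_{\widehat w}=\widehat\mu_{\widehat w}$ whenever $\widehat s_j\widehat w<\widehat w$), one has $\widehat f_j\widehat P=\Phi(f_j^\omega P)=\widetilde P(\mu'_\bullet)\cap\mathfrak h^\omega$ for $\widehat P=\Phi(P)$ and $\mu'_\bullet$ the GGMS datum of $f_j^\omega P$. *)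

(* Defs.v *)
From HB Require Import structures.
From mathcomp Require Import all_boot all_order all_algebra.
From mathcomp Require Import all_classical all_reals.

Set Implicit Arguments.
Unset Strict Implicit.
Unset Printing Implicit Defensive.

Import Order.TTheory GRing.Theory Num.Theory.

Local Open Scope classical_set_scope.
Local Open Scope ring_scope.

(* Simple Lie algebras enter only through their Cartan matrix                 *)
(* A i j = <alpha_j, h_i>.  The real form of the Cartan subalgebra is the     *)
(* space 'cV[R]_r of coordinates in the basis of simple coroots, functionals  *)
(* are row vectors, and Weyl group elements are matrices acting by w *m h.    *)
(* Indices are 0-based.                                                       *)
(*                                                                            *)
(* A family (mu_w) indexed by the Weyl group is a function on all matrices;   *)
(* only its values at Weyl group elements are ever used.                      *)

Definition coroot (R : realType) (r : nat) (i : 'I_r) : 'cV[R]_r :=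
  delta_mx i 0.

Definition root (R : realType) (r : nat) (A : 'M[int]_r) (i : 'I_r) :
    'rV[R]_r :=
  \row_k (A k i)%:~R.

Definition fweight (R : realType) (r : nat) (i : 'I_r) : 'rV[R]_r :=
  delta_mx 0 i.

Definition pairing (R : realType) (r : nat) (f : 'rV[R]_r) (h : 'cV[R]_r) : R :=
  (f *m h) 0 0.

Definition refl (R : realType) (r : nat) (A : 'M[int]_r) (i : 'I_r) : 'M[R]_r :=
  1%:M - coroot R i *m root R A i.

Definition word_prod (R : realType) (r m : nat) (s : 'I_r -> 'M[R]_m)
    (t : seq 'I_r) : 'M[R]_m :=
  foldr (fun i w => s i *m w) 1%:M t.

Definition weyl (R : realType) (r : nat) (A : 'M[int]_r) : set 'M[R]_r :=
  range (word_prod (refl R A)).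

(* length v < length w, the length being the least size of a word in the      *)
(* simple reflections: some word for v is smaller than all words for w.       *)
Definition shorter (R : realType) (r : nat) (A : 'M[int]_r)
    (v w : 'M[R]_r) : Prop :=
  exists2 t, v = word_prod (refl R A) t &
    forall t', w = word_prod (refl R A) t' -> (size t < size t')%N.

Definition longest (R : realType) (r : nat) (A : 'M[int]_r)
    (w0 : 'M[R]_r) : Prop :=
  weyl A w0 /\ forall w, weyl A w -> w <> w0 -> shorter A w w0.

(* h >=_w h' : coordinates of w^-1 h - w^-1 h' on the simple coroots are >= 0 *)
Definition weyl_ge (R : realType) (r : nat) (w : 'M[R]_r)
    (h h' : 'cV[R]_r) : Prop :=
  forall i, 0 <= (invmx w *m h - invmx w *m h') i 0.

Definition isV (R : realType) (r : nat) (A : 'M[int]_r)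
    (mu : 'M[R]_r -> 'cV[R]_r) : Prop :=
  (forall w w', weyl A w -> weyl A w' -> weyl_ge w (mu w') (mu w)) /\
  (exists2 w0, longest A w0 & mu w0 = 0).

Definition polytope (R : realType) (r : nat) (A : 'M[int]_r)
    (mu : 'M[R]_r -> 'cV[R]_r) : set 'cV[R]_r :=
  [set h | forall w, weyl A w -> weyl_ge w h (mu w)].

Definition ggms (R : realType) (r : nat) (A : 'M[int]_r) (P : set 'cV[R]_r)
    (mu : 'M[R]_r -> 'cV[R]_r) : Prop :=
  isV A mu /\ P = polytope A mu.

(* M_{w Lambda_i} = <w Lambda_i, mu_w>, where w Lambda_i is the functional    *)
(* h |-> <Lambda_i, w^-1 h>.                                                  *)
Definition Mdata (R : realType) (r : nat) (mu : 'M[R]_r -> 'cV[R]_r)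
    (w : 'M[R]_r) (i : 'I_r) : R :=
  pairing (fweight R i *m invmx w) (mu w).

(* In types A and B the only off-diagonal pairs (A i j, A j i) are (0, 0),    *)
(* which carries no condition, and the three below.                           *)
Definition tropical_plucker (R : realType) (r : nat) (A : 'M[int]_r)
    (mu : 'M[R]_r -> 'cV[R]_r) : Prop :=
  let M := Mdata mu in let s := refl R A in
  forall (w : 'M[R]_r) (i j : 'I_r), weyl A w -> i != j ->
    shorter A w (w *m s i) -> shorter A w (w *m s j) ->
  [/\ A i j = - 1 -> A j i = - 1 ->
        M (w *m s i) i + M (w *m s j) j =
        Num.min (M w i + M (w *m s i *m s j) j)
                (M (w *m s j *m s i) i + M w j),
      A i j = - 1 -> A j i = - 2%:Z ->
        M (w *m s j) j + M (w *m s i *m s j) j + M (w *m s i) i =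
        Num.min (2 * M (w *m s i *m s j) j + M w i)
       (Num.min (2 * M w j + M (w *m s i *m s j *m s i) i)
                (M w j + M (w *m s j *m s i *m s j) j + M (w *m s i) i))
        /\
        M (w *m s j *m s i) i + 2 * M (w *m s i *m s j) j + M (w *m s i) i =
        Num.min (2 * M w j + 2 * M (w *m s i *m s j *m s i) i)
       (Num.min (2 * M (w *m s j *m s i *m s j) j + 2 * M (w *m s i) i)
                (M (w *m s i *m s j *m s i) i + 2 * M (w *m s i *m s j) j
                 + M w i)) &
      A i j = - 2%:Z -> A j i = - 1 ->
        M (w *m s j *m s i) i + M (w *m s i) i + M (w *m s i *m s j) j =
        Num.min (2 * M (w *m s i) i + M (w *m s j *m s i *m s j) j)
       (Num.min (2 * M (w *m s i *m s j *m s i) i + M w j)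
                (M (w *m s i *m s j *m s i) i + M w i + M (w *m s i *m s j) j))
        /\
        M (w *m s j) j + 2 * M (w *m s i) i + M (w *m s i *m s j) j =
        Num.min (2 * M (w *m s i *m s j *m s i) i + 2 * M w j)
       (Num.min (2 * M w i + 2 * M (w *m s i *m s j) j)
                (M w j + 2 * M (w *m s i) i + M (w *m s j *m s i *m s j) j))].

Definition isMV (R : realType) (r : nat) (A : 'M[int]_r)
    (P : set 'cV[R]_r) : Prop :=
  exists mu, [/\ ggms A P mu,
    forall w i, weyl A w -> Mdata mu w i \is a Num.int &
    tropical_plucker A mu].

(* Graph of the lowering Kashiwara operator f_j: P' = f_j P.                  *)
Definition lowering (R : realType) (r : nat) (A : 'M[int]_r) (j : 'I_r)
    (P P' : set 'cV[R]_r) : Prop :=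
  [/\ isMV A P, isMV A P' &
    exists mu mu', [/\ ggms A P mu, ggms A P' mu',
      mu' 1%:M = mu 1%:M - coroot R j &
      forall w, weyl A w -> shorter A (refl R A j *m w) w -> mu' w = mu w]].

Definition cartanA (l : nat) : 'M[int]_l :=
  \matrix_(i, j) (if i == j then 2%:Z
                  else if (i.+1 == j :> nat) || (j.+1 == i :> nat) then - 1
                  else 0).

(* The last row is the one of the long coroot, so the last simple root is     *)
(* the short one.                                                             *)
Definition cartanB (n : nat) : 'M[int]_n :=
  \matrix_(i, j) (if i == j then 2%:Z
                  else if (i.+1 == j :> nat) then - 1
                  else if (j.+1 == i :> nat) then
                    (if i.+1 == n :> nat then - 2%:Z else - 1)
                  else 0).

(* From here on l = 2n is written n + n, the index set {1..n} is 'I_n,        *)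
(* embedded in 'I_(n + n) by lshift, and the diagram automorphism is rev_ord. *)

Definition idx (n : nat) (j : 'I_n) : 'I_(n + n) := lshift n j.
Definition idx_omega (n : nat) (j : 'I_n) : 'I_(n + n) := rev_ord (idx j).

Definition omega_h (R : realType) (n : nat) (h : 'cV[R]_(n + n)) :
    'cV[R]_(n + n) :=
  \col_i h (rev_ord i) 0.

(* Conjugation by omega_h, which sends refl i to refl (rev_ord i).            *)
Definition omega_W (R : realType) (n : nat) (w : 'M[R]_(n + n)) :
    'M[R]_(n + n) :=
  \matrix_(i, k) w (rev_ord i) (rev_ord k).

Definition Womega (R : realType) (n : nat) : set 'M[R]_(n + n) :=
  [set w | weyl (cartanA (n + n)) w /\ omega_W w = w].

Definition isVomega (R : realType) (n : nat)
    (mu : 'M[R]_(n + n) -> 'cV[R]_(n + n)) : Prop :=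
  isV (cartanA (n + n)) mu /\
  forall w, weyl (cartanA (n + n)) w -> omega_h (mu (omega_W w)) = mu w.

Definition isMVomega (R : realType) (n : nat)
    (P : set 'cV[R]_(n + n)) : Prop :=
  isMV (cartanA (n + n)) P /\
  exists2 mu, ggms (cartanA (n + n)) P mu & isVomega mu.

Definition lowering_omega (R : realType) (n : nat) (j : 'I_n)
    (P P' : set 'cV[R]_(n + n)) : Prop :=
  let f := lowering (cartanA (n + n)) in
  if j.+1 == n then
    exists P1 P2 P3, [/\ f (idx j) P P1, f (idx_omega j) P1 P2,
                         f (idx_omega j) P2 P3 & f (idx j) P3 P']
  else exists2 P1, f (idx_omega j) P P1 & f (idx j) P1 P'.

Definition refl_omega (R : realType) (n : nat) (j : 'I_n) : 'M[R]_(n + n) :=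
  let s := refl R (cartanA (n + n)) in
  if j.+1 == n then s (idx j) *m s (idx_omega j) *m s (idx j)
  else s (idx j) *m s (idx_omega j).

Definition coroot_omega (R : realType) (n : nat) (j : 'I_n) : 'cV[R]_(n + n) :=
  if j.+1 == n then 2 *: (coroot R (idx j) + coroot R (idx_omega j))
  else coroot R (idx j) + coroot R (idx_omega j).

Definition Womega_plus (R : realType) (n : nat) (j : 'I_n) :
    set 'M[R]_(n + n) :=
  [set w | Womega w /\ shorter (cartanA (n + n)) w (refl_omega R j *m w)].

Definition Womega_minus (R : realType) (n : nat) (j : 'I_n) :
    set 'M[R]_(n + n) :=
  [set w | Womega w /\ shorter (cartanA (n + n)) (refl_omega R j *m w) w].

Definition polytope_tilde (R : realType) (n : nat)
    (mu : 'M[R]_(n + n) -> 'cV[R]_(n + n)) : set 'cV[R]_(n + n) :=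
  [set h | forall w, Womega w -> weyl_ge w h (mu w)].

(* Graph of the isomorphism Theta from the Weyl group of type B_n to the      *)
(* omega-fixed subgroup determined by Theta (s_i) = s_i^omega.                *)
Definition Theta (R : realType) (n : nat) (what : 'M[R]_n)
    (w : 'M[R]_(n + n)) : Prop :=
  exists t : seq 'I_n, what = word_prod (refl R (cartanB n)) t /\
                       w = word_prod (@refl_omega R n) t.

(* Inclusion of the omega-fixed part, given by coordinates in the basis of    *)
(* simple coroots of the fixed point algebra.                                 *)
Definition h_omega_incl (R : realType) (n : nat) (x : 'cV[R]_n) :
    'cV[R]_(n + n) :=
  \sum_(j < n) x j 0 *: coroot_omega R j.

(* Graph of the map Phi: Phat = Phi P.                                        *)
Definition Phi (R : realType) (n : nat) (P : set 'cV[R]_(n + n))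
    (Phat : set 'cV[R]_n) : Prop :=
  exists mu muhat, [/\ ggms (cartanA (n + n)) P mu,
    forall what w, Theta what w -> h_omega_incl (muhat what) = mu w &
    Phat = polytope (cartanB n) muhat].

Definition sigma (R : realType) (n : nat) (i : 'I_(n + n)) (c : R)
    (h : 'cV[R]_(n + n)) : 'cV[R]_(n + n) :=
  refl R (cartanA (n + n)) i *m h + c *: coroot R i.

(* Conditions (i)-(v) on mu'' relative to mu, for the index j.                *)
Definition conditions (R : realType) (n : nat) (j : 'I_n)
    (mu : 'M[R]_(n + n) -> 'cV[R]_(n + n)) (c : R)
    (mu'' : 'M[R]_(n + n) -> 'cV[R]_(n + n)) : Prop :=
  let A := cartanA (n + n) in
  let P := polytope_tilde mu'' in
  let sg := sigma (idx j) c in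
  let tau := sigma (idx_omega j) c in
  [/\ forall w, Womega_minus j w -> mu'' w = mu w,
      mu'' 1%:M = mu 1%:M - coroot_omega R j,
      forall w, Womega_plus j w -> P (mu w),
      (forall w, weyl A w -> shorter A (refl R A (idx j) *m w) w ->
         c <= pairing (root R A (idx j)) (mu w) -> P (sg (mu w))) /\
      (forall w, weyl A w -> shorter A (refl R A (idx_omega j) *m w) w ->
         c <= pairing (root R A (idx_omega j)) (mu w) -> P (tau (mu w))) &
      forall w, Womega_minus j w ->
         c <= pairing (root R A (idx j)) (mu w) -> P (sg (tau (sg (mu w))))].

(* Main.v *)
Require Import Defs.
From HB Require Import structures.
From mathcomp Require Import all_boot all_order all_fingroup all_algebra.
From mathcomp Require Import zify ring lra.
From mathcomp Require Import all_classical all_reals.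

(** The Weyl group of type A_l is the symmetric group on l + 1 letters: with
    eps_0, ..., eps_l the weights of the vector representation, an element
    [permW p] sends eps_k to eps_(p k) on the right, and the chamber weights
    w Lambda_i are the sums [wt S] of the eps_k over sets S of letters.  A
    pseudo-Weyl polytope is therefore encoded by the numbers M_S, its support
    function [supp] on the functionals [wt S], and h lies in the polytope iff
    <wt S, h> >= M_S.

    The heart of the proof is a formula for f_j ([lowering_supp]): it replaces
    M_S by min(M_S, M_(s_j S) + c_j) when S contains the letter j but not j + 1,
    with c_j = M_(Lambda_j) - M_(s_j Lambda_j) - 1, and changes nothing else.
    This is the uniqueness half of the characterisation of f_j.  The conditions
    defining f_j fix M_S for all other S and for S = {1..j}, and the
    tropical Pluecker relation for three letters j, j + 1, a on a set T relates
    the value at T + j to the value at T + a + j; so all values follow from the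
    one at {1..j} by adding and removing letters one at a time, and the recursion
    preserves the shape of the formula ([lowered_step]).

    Let a, b, c be the letters n, n + 1, n + 2, which the diagram automorphism
    exchanges through a <-> c.  When the polytope is invariant, the Pluecker
    relation at {1..n-1} makes the constants of the four successive operators in
    f_n f_(n+1)^2 f_n combine to one and the same c ([lowered_compose]), and the
    result is: M_a becomes min(M_a, M_b + c, M_c + 2c), M_ab becomes
    min(M_ab, M_ac + c, M_bc + 2c), M_b becomes min(M_b, M_c + c), M_ac becomes
    min(M_ac, M_bc + c), over any fixed set of further letters.  This formula is
    visibly invariant, so the result stays in the fixed locus.

    The facets of the polytopes of the fixed locus are cut out by the sets S
    that are initial segments of centrally symmetric permutations, and these meet
    {a, b, c} in none, a, c, ab, bc or abc ([seg_letters]).  The affine reflections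
    sigma and tau act on the eps_a, eps_b, eps_c coordinates by exchanging two of
    them and shifting by c, and so conditions (i)-(v) reduce to linear
    inequalities between the coordinates of mu_w.  Conversely each of the terms of
    the minima is attained at a vertex: M_S at mu_w for w in W_+, the term with c
    at the sigma or tau image of the vertex for s_j w or s_(omega(j)) w, the
    term with 2c at the sigma tau sigma image of the vertex for s_n^omega w.  When the inequality
    required in (iv) or (v) fails at that vertex, the vertex itself shows that
    M_S is not larger than the term in question, so that the bound by M_S is
    enough ([supp_le_minimal]). *)

Import Order.TTheory GRing.Theory Num.Theory.

Local Open Scope ring_scope.

Set Implicit Arguments.
Unset Strict Implicit.

(** * Inversions of a permutation *)

Section Inversions.
Context (N : nat).
Implicit Types (p : 'S_N) (a b : 'I_N).

Definition inversions p : {set 'I_N * 'I_N} :=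
  [set u : 'I_N * 'I_N | (u.1 < u.2)%N && (p u.2 < p u.1)%N]%SET.

(** An involution on increasing pairs, which compares the inversions of p with
    those of p composed with the transposition of a and b. *)
Definition swap_pair a b (u : 'I_N * 'I_N) : 'I_N * 'I_N :=
  if (tperm a b u.1 < tperm a b u.2)%N then (tperm a b u.1, tperm a b u.2)
  else u.

Lemma swap_pairK a b (u : 'I_N * 'I_N) :
  (u.1 < u.2)%N -> swap_pair a b (swap_pair a b u) = u.
Proof.
case: u => x y /= xy; rewrite {2}/swap_pair /=; case: ifP => h.
  by rewrite /swap_pair /= !tpermK xy.
by rewrite /swap_pair /= h.
Qed.

Lemma swap_pair_inj p a b : {in inversions p &, injective (swap_pair a b)}.
Proof.
move=> u v; rewrite !inE => /andP[hu _] /andP[hv _] /(congr1 (swap_pair a b)).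
by rewrite !swap_pairK.
Qed.

(** The map [swap_pair a b] embeds the inversions of p into those of
    [tperm a b * p], and the pair (a, b), which it fixes, is a new inversion. *)
Lemma ltn_inversions p a b : (a < b)%N -> (p a < p b)%N ->
  (#|inversions p| < #|inversions (tperm a b * p)|)%N.
Proof.
move=> ab pab; rewrite -(card_in_imset (@swap_pair_inj p a b)).
apply/proper_card/properP; split.
  apply/fintype.subsetP => z /imsetP[[x y]]; rewrite inE /= => /andP[xy pyx] ->.
  rewrite /swap_pair /=; case: ifP => h; rewrite inE /= !permM ?tpermK.
    by rewrite h.
  rewrite xy /=; move: h; case: tpermP => [ex|ex|/eqP xa /eqP xb];
    case: tpermP => [ey|ey|/eqP ya /eqP yb]; subst; try lia.
exists (a, b); first by rewrite inE /= ab !permM tpermL tpermR.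
apply/imsetP => -[[x y]]; rewrite inE /= => /andP[xy pyx] /(congr1 (swap_pair a b)).
rewrite swap_pairK //= /swap_pair /= tpermL tpermR ltnNge (ltnW ab) /=.
by case=> ex ey; move: pyx; rewrite -ex -ey ltnNge (ltnW pab).
Qed.

(** For adjacent letters, (a, b) is the only pair that [swap_pair a b] does not
    move by the transposition itself. *)
Lemma leq_inversions p a b : b = a.+1 :> nat ->
  (#|inversions (tperm a b * p)| <= #|inversions p|.+1)%N.
Proof.
move=> ab; rewrite (cardsD1 (a, b)) -add1n leq_add ?leq_b1 //.
rewrite -(card_in_imset (f := swap_pair a b)); last first.
  by move=> u v; rewrite !in_setD1 => /andP[_ hu] /andP[_ hv]; apply: swap_pair_inj hu hv.
apply/subset_leq_card/fintype.subsetP => z /imsetP[[x y]].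
rewrite !inE /= !permM => /andP[nab /andP[xy]] + ->.
rewrite /swap_pair /=; case: ifP => /= h; first by rewrite h.
suff: (x, y) = (a, b) by move=> e; rewrite e eqxx in nab.
move: h nab xy ab; case: tpermP => [ex|ex|/eqP + /eqP +];
  case: tpermP => [ey|ey|/eqP + /eqP +] //; subst => //;
  rewrite ?xpair_eqE -?(inj_eq val_inj) /=; lia.
Qed.

End Inversions.

(** * Permutation matrices in the basis of simple coroots *)

Section Permutations.
Context (R : realType) (l : nat).
Implicit Types (p q : 'S_l.+1) (k : 'I_l.+1) (i : 'I_l) (S : {set 'I_l.+1}).

(** Weights of the vector representation, written in the basis of fundamental
    weights: eps_k = Lambda_(k+1) - Lambda_k in the usual numbering, where the
    two extreme fundamental weights are 0. *)
Definition eps k : 'rV[R]_l :=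
  \row_m ((m == k :> nat)%:R - (m.+1 == k :> nat)%:R).

Definition wt S : 'rV[R]_l := \sum_(k in S) eps k.

Definition lo i : 'I_l.+1 := widen_ord (leqnSn l) i.
Definition hi i : 'I_l.+1 := lift ord0 i.
Definition swp i : 'S_l.+1 := tperm (lo i) (hi i).

Arguments lo : simpl never.
Arguments hi : simpl never.

Lemma ord_eqE m (a b : 'I_m) : (a == b) = (a == b :> nat). Proof. by []. Qed.

Lemma loE i : lo i = i :> nat. Proof. by []. Qed.

Lemma hiE i : hi i = i.+1 :> nat. Proof. exact: lift0. Qed.

Lemma lo_hi i : (lo i == hi i) = false.
Proof. by apply/negbTE; rewrite ord_eqE loE hiE neq_ltn ltnSn. Qed.

Lemma sum_eps (f : 'I_l.+1 -> R) m :
  \sum_k f k * eps k 0 m = f (lo m) - f (hi m).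
Proof.
rewrite (bigD1 (lo m)) //= (bigD1 (hi m)) /=; last by rewrite eq_sym lo_hi.
rewrite big1 => [|k /andP[]].
  rewrite !mxE loE hiE eqxx eqSS ![_ == m.+1]eq_sym ![m.+1 == _]eq_sym.
  by rewrite eqxx (ltn_eqF (ltnSn m)) /=; lra.
rewrite !ord_eqE loE hiE => k1 k2.
by rewrite !mxE !(eq_sym _ (nat_of_ord k)) (negbTE k1) (negbTE k2) subrr mulr0.
Qed.

Lemma fweight_wt i : fweight R i = wt [set k : 'I_l.+1 | (k <= i)%N]%SET.
Proof.
apply/rowP => m; rewrite !mxE summxE eqxx /=.
rewrite [LHS](_ : _ = (m <= i)%:R - (m.+1 <= i)%:R); last first.
  by rewrite ord_eqE; case: ltngtP => _; rewrite /=; lra.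
rewrite -(hiE m) -[m in (m <= i)%N]/(val (lo m)) -(sum_eps (fun k => (k <= i)%:R)).
rewrite [RHS]big_mkcond; apply: eq_bigr => k _; rewrite inE.
by case: ifP; rewrite ?mul1r ?mul0r.
Qed.

Lemma wtT : wt [set: 'I_l.+1]%SET = 0.
Proof.
apply/rowP => m; rewrite !mxE summxE.
rewrite -[RHS](subrr 1) -(sum_eps (fun=> 1) m).
by apply: eq_big => k; rewrite ?inE ?mul1r.
Qed.

Lemma wt0 : wt finset.set0 = 0. Proof. by rewrite /wt big_set0. Qed.

Lemma wt1 k : wt [set k]%SET = eps k. Proof. by rewrite /wt big_set1. Qed.

Lemma initS k :
  [set m : 'I_l.+1 | (m < k.+1)%N]%SET = (k |: [set m : 'I_l.+1 | (m < k)%N])%SET.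
Proof. by apply/finset.setP => m; rewrite !inE ord_eqE ltnS leq_eqVlt. Qed.

Lemma eps_wt k : eps k =
  wt [set m : 'I_l.+1 | (m < k.+1)%N]%SET - wt [set m : 'I_l.+1 | (m < k)%N]%SET.
Proof.
rewrite initS.
by rewrite /wt finset.big_setU1 ?addrK // inE ltnn.
Qed.

Lemma wtC S : wt (~: S) = - wt S.
Proof.
have := wtT; rewrite /wt (finset.big_setID S) finset.setTI finset.setTD => /eqP.
by rewrite /= addrC addr_eq0 => /eqP.
Qed.

(** The fundamental weights are partial sums of the eps_k, so the latter span. *)
Lemma mx_epsP m (v w : 'M[R]_(l, m)) : (forall k, eps k *m v = eps k *m w) -> v = w.
Proof.
move=> h; apply/row_matrixP => i; rewrite !rowE -!/(fweight R i) !fweight_wt.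
by rewrite !mulmx_suml; apply: eq_bigr.
Qed.

(** The row of index i must be the image of Lambda_i, the sum of the first letters. *)
Definition permW p : 'M[R]_l := \matrix_i (wt (p @: [set k : 'I_l.+1 | (k <= i)%N]))%SET.

Lemma wt_imset p S : wt (p @: S) = \sum_(k in S) eps (p k).
Proof. by rewrite /wt big_imset //= => x y _ _; apply: perm_inj. Qed.

(** Every eps_k is a difference of two consecutive initial sums.  The rows of
    [permW p] give the images of the proper ones; the full sum is 0, which makes
    the formula hold for the last letter too. *)
Lemma eps_permW p k : eps k *m permW p = eps (p k).
Proof.
have seg d : (d <= l.+1)%N -> wt [set m : 'I_l.+1 | (m < d)%N]%SET *m permW p =
   wt (p @: [set m : 'I_l.+1 | (m < d)%N]%SET).
  case: d => [_|d].
    by rewrite (_ : finset _ = finset.set0) ?imset0 ?wt0 ?mul0mx.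
  rewrite ltnS leq_eqVlt => /predU1P[->|dl].
    rewrite (_ : finset _ = finset.setT); last by apply/finset.setP => m; rewrite !inE ltn_ord.
    rewrite (_ : p @: _ = finset.setT) ?wtT ?mul0mx //.
    by apply/finset.setP => m; rewrite -(permKV p m) imset_f !inE.
  have := fweight_wt (Ordinal dl) => /= <-.
  by rewrite -rowE rowK.
rewrite {1}eps_wt mulmxBl !seg //; last exact: ltnW.
rewrite !wt_imset -[RHS](addrK (\sum_(m in [set m : 'I_l.+1 | (m < k)%N]%SET) eps (p m))).
by congr (_ - _); rewrite initS finset.big_setU1 //= inE ltnn.
Qed.

Lemma wt_permW p S : wt S *m permW p = wt (p @: S).
Proof. by rewrite wt_imset mulmx_suml; apply: eq_bigr => k _; rewrite eps_permW. Qed.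

Lemma permWM p q : permW (p * q) = permW p *m permW q.
Proof. by apply: mx_epsP => k; rewrite mulmxA !eps_permW permM. Qed.

Lemma permW1 : permW 1 = 1%:M.
Proof. by apply: mx_epsP => k; rewrite eps_permW mulmx1 perm1. Qed.

Lemma invmx_permW p : invmx (permW p) = permW p^-1.
Proof.
have h : permW p *m permW p^-1 = 1%:M by rewrite -permWM mulgV permW1.
have [u _] := mulmx1_unit h.
by rewrite -[RHS]mul1mx -(mulVmx u) -mulmxA h mulmx1.
Qed.

(** With w = [permW p] this is the set S for which w Lambda_i = [wt S], see
    [fweight_permW]. *)
Definition seg p i : {set 'I_l.+1} := [set k : 'I_l.+1 | (p k <= i)%N]%SET.

Lemma fweight_permW p i : fweight R i *m invmx (permW p) = wt (seg p i).
Proof.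
rewrite invmx_permW fweight_wt wt_permW; congr wt; apply/finset.setP => k.
by rewrite -{1}(permK p k) finset.mem_imset ?inE //; apply: perm_inj.
Qed.

Lemma root_eps i : Defs.root R (cartanA l) i = eps (lo i) - eps (hi i).
Proof.
apply/rowP => m; rewrite !mxE loE hiE ord_eqE eqSS /=.
by case: (ltngtP m i) => h /=; rewrite ?(gtn_eqF h) ?(ltn_eqF h) ?orbF;
  repeat case: eqP => /=; try lia; rewrite ?rmorphN ?rmorph1 ?rmorph0 //=; try lra.
Qed.

Lemma eps_coroot k i :
  eps k *m coroot R i = ((k == lo i)%:R - (k == hi i)%:R)%:M.
Proof.
rewrite -colE; apply/matrixP => a b; rewrite !ord1 !mxE eqxx mulr1n !ord_eqE loE hiE.
by rewrite !(eq_sym _ (nat_of_ord k)).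
Qed.

Lemma pairingD (f : 'rV[R]_l) g h : pairing f (g + h) = pairing f g + pairing f h.
Proof. by rewrite /pairing mulmxDr mxE. Qed.

Lemma pairingB (f : 'rV[R]_l) g h : pairing f (g - h) = pairing f g - pairing f h.
Proof. by rewrite /pairing mulmxBr [LHS]mxE [X in _ + X]mxE. Qed.

Lemma pairingZ (f : 'rV[R]_l) a h : pairing f (a *: h) = a * pairing f h.
Proof. by rewrite /pairing -scalemxAr mxE. Qed.

Lemma pairing_fweight i h : pairing (fweight R i) h = h i 0.
Proof. by rewrite /pairing -rowE mxE. Qed.

Lemma pairing_coroot S i :
  pairing (wt S) (coroot R i) = (lo i \in S)%:R - (hi i \in S)%:R.
Proof.
rewrite /pairing -colE mxE /wt summxE big_mkcond /=.
have := @sum_eps (fun k => (k \in S)%:R) i => /= <-.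
by apply: eq_bigr => k _; case: (k \in S); rewrite ?mul1r ?mul0r.
Qed.

Lemma refl_permW i : refl R (cartanA l) i = permW (swp i).
Proof.
apply: mx_epsP => k; rewrite eps_permW /refl mulmxBr mulmx1 mulmxA eps_coroot.
rewrite mul_scalar_mx root_eps.
have := lo_hi i; case: tpermP => [->|->|/eqP/negbTE-> /eqP/negbTE->].
- by rewrite eqxx => ->; rewrite subr0 scale1r opprB addrC subrK.
- by rewrite eqxx eq_sym => ->; rewrite sub0r scaleN1r opprK addrC subrK.
- by rewrite subrr scale0r subr0.
Qed.

Lemma eps_inj : injective eps.
Proof.
suff h k k' : (k < k')%N -> eps k <> eps k'.
  move=> k k' e; apply/val_inj => /=.
  by case: (ltngtP k k') => // /h; rewrite e.
move=> kk' /rowP /(_ (Ordinal (leq_trans kk' (ltn_ord k' : (k' <= l)%N)))).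
rewrite !mxE /= eqxx (gtn_eqF (ltnSn k)) (ltn_eqF kk').
by case: eqP => _; rewrite /= => e; lra.
Qed.

Lemma permW_inj : injective permW.
Proof.
move=> p q e; apply/permP => k; apply: eps_inj.
by rewrite -!eps_permW e.
Qed.

End Permutations.

(** * Lengths, support functions and three-term relations *)

Section Weyl.
Context (R : realType) (l : nat).
Implicit Types (p q : 'S_l.+1) (k : 'I_l.+1) (i j : 'I_l) (S T : {set 'I_l.+1}).
Implicit Types (mu : 'M[R]_l -> 'cV[R]_l).

Local Notation A := (cartanA l).
Local Notation permW := (@permW R l).
Local Notation wt := (@wt R l).

Lemma word_prod_permW (t : seq 'I_l) : word_prod (refl R A) t =
  permW (foldr (fun i p => (swp i * p)%g) 1%g t).
Proof.
elim: t => [|i t IH] /=; first by rewrite permW1.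
by rewrite IH refl_permW permWM.
Qed.

Lemma leq_inversions_size (t : seq 'I_l) :
  (#|inversions (foldr (fun i p => (swp i * p)%g) 1%g t)| <= size t)%N.
Proof.
elim: t => [|i t IH] /=.
  rewrite leqn0 cards_eq0; apply/eqP/finset.setP => -[x y].
  by rewrite !inE !perm1 /=; lia.
by apply: leq_trans (leq_inversions _ _) _; rewrite ?hiE.
Qed.

(** Such a permutation satisfies k <= p k for all k, and the two sides have the
    same sum. *)
Lemma no_descent_perm1 p : (forall i, (p (lo i) < p (hi i))%N) -> p = 1%g.
Proof.
move=> h.
have le_p k : (k <= p k)%N.
  case: k => m; elim: m => [//|m IH] hm /=.
  have hm' : (m < l)%N by [].
  have := h (Ordinal hm'); have := IH (ltnW hm).
  rewrite (_ : lo _ = Ordinal (ltnW hm)); last exact/val_inj.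
  rewrite (_ : hi _ = Ordinal hm); last by apply: ord_inj; rewrite hiE.
  by move=> /=; apply: leq_ltn_trans.
have /eqP : (\sum_(k < l.+1) (k : nat) = \sum_k (p k : nat))%N.
  by rewrite [LHS](reindex_inj (@perm_inj _ p)).
rewrite (@leqif_sum _ xpredT (fun k => (k == p k :> nat)) _ _ _) => [/forallP e|k _].
  by apply/permP => k; rewrite perm1; apply/val_inj/esym/eqP/(implyP (e k)).
exact: leqif_eq.
Qed.

(** Removing a descent of p lowers the number of inversions.  With
    [leq_inversions_size] this makes the number of inversions the length. *)
Lemma reduced_word p :
  exists2 t, permW p = word_prod (refl R A) t & (size t <= #|inversions p|)%N.
Proof.
have [m] := ubnP #|inversions p|; elim: m p => // m IH p; rewrite ltnS => pm.
have [/forallP h|] := boolP [forall i, (p (lo i) < p (hi i))%N].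
  by rewrite (no_descent_perm1 h); exists [::] => //=; rewrite permW1.
rewrite negb_forall => /existsP[i hi_].
have lt_p : (#|inversions (swp i * p)| < #|inversions p|)%N.
  rewrite -{2}(mulKg (swp i) p) tpermV; apply: ltn_inversions.
    by rewrite hiE.
  rewrite !permM tpermL tpermR ltn_neqAle leqNgt hi_ andbT.
  by rewrite -ord_eqE (inj_eq perm_inj) eq_sym lo_hi.
have [t ht st] := IH _ (leq_trans lt_p pm).
exists (i :: t); last exact: leq_ltn_trans st lt_p.
by rewrite /= -ht refl_permW -permWM mulgA tperm2 mul1g.
Qed.

Lemma weylP (w : 'M[R]_l) : weyl A w <-> exists p, w = permW p.
Proof.
split=> [[t _ <-]|[p ->]]; first by rewrite word_prod_permW; eexists.
by have [t -> _] := reduced_word p; exists t.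
Qed.

Lemma weyl_permW p : weyl A (permW p).
Proof. by apply/weylP; exists p. Qed.

Lemma shorter_tperm p (a b : 'I_l.+1) : (a < b)%N -> (p a < p b)%N ->
  shorter A (permW p) (permW (tperm a b * p)).
Proof.
move=> ab pab; have [t -> st] := reduced_word p; exists t => // t'.
rewrite word_prod_permW => /permW_inj e.
apply: leq_ltn_trans st _; apply: leq_trans (leq_inversions_size t').
by rewrite -e ltn_inversions.
Qed.

Lemma shorter_refl_r p i (a b : 'I_l.+1) : (a < b)%N -> p a = lo i -> p b = hi i ->
  shorter A (permW p) (permW p *m refl R A i).
Proof.
move=> ab pa pb; rewrite refl_permW -permWM /swp -pa -pb -tpermJ -conjgC.
by apply: shorter_tperm => //; rewrite pa pb hiE.
Qed.

Lemma shorter_asym (v w : 'M[R]_l) : shorter A v w -> ~ shorter A w v.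
Proof.
case=> t ht mt [t' ht' mt']; have := mt _ ht'; have := mt' _ ht.
by move=> h /ltn_trans/(_ h); rewrite ltnn.
Qed.

Lemma weyl_geP p (h h' : 'cV[R]_l) : weyl_ge (permW p) h h' <->
  forall i, pairing (wt (seg p i)) h' <= pairing (wt (seg p i)) h.
Proof.
have e i : (invmx (permW p) *m h - invmx (permW p) *m h') i 0 =
    pairing (wt (seg p i)) h - pairing (wt (seg p i)) h'.
  rewrite /pairing -fweight_permW /fweight -!mulmxA -!rowE.
  by rewrite !mxE.
by split=> H i; have := H i; rewrite e subr_ge0.
Qed.

(** The weights [wt (seg p i)] for fixed p are the images of the fundamental
    weights, a basis. *)
Lemma pairing_segP p (h h' : 'cV[R]_l) :
  (forall i, pairing (wt (seg p i)) h = pairing (wt (seg p i)) h') -> h = h'.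
Proof.
move=> e; have u : permW p \in unitmx.
  by case: (@mulmx1_unit _ _ (permW p) (permW p^-1)); rewrite // -permWM mulgV permW1.
rewrite -(mulKVmx u h) -(mulKVmx u h'); congr (_ *m _); apply/colP => i.
have := e i; rewrite /pairing -fweight_permW /fweight -!mulmxA -!rowE.
by rewrite !mxE.
Qed.

(** The minimum of the functional [wt S] over the vertices.  The GGMS inequalities
    say that it is attained at every w with w Lambda_i = [wt S], so this is the
    number M_(w Lambda_i), and its dependence on w Lambda_i alone is built in. *)
Definition supp mu S : R :=
  \big[Num.min/pairing (wt S) (mu 1%:M)]_p pairing (wt S) (mu (permW p)).

Lemma supp_le mu p S : supp mu S <= pairing (wt S) (mu (permW p)).
Proof. exact: bigmin_le. Qed.

Lemma supp_seg mu p i : isV A mu ->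
  supp mu (seg p i) = pairing (wt (seg p i)) (mu (permW p)).
Proof.
move=> [Vmu _]; apply/eqP; rewrite eq_le supp_le /=.
have h q : pairing (wt (seg p i)) (mu (permW p)) <= pairing (wt (seg p i)) (mu (permW q)).
  exact: (iffLR (weyl_geP _ _ _) (Vmu _ _ (weyl_permW p) (weyl_permW q))).
by apply: le_bigmin => [|q _]; rewrite -?permW1.
Qed.

Lemma Mdata_supp mu p i : isV A mu -> Mdata mu (permW p) i = supp mu (seg p i).
Proof. by move=> V; rewrite supp_seg // /Mdata fweight_permW. Qed.

Lemma eq_supp mu mu' : (forall p, mu (permW p) = mu' (permW p)) ->
  forall S, supp mu S = supp mu' S.
Proof.
move=> e S; rewrite /supp -permW1 e; apply: eq_bigr => p _; by rewrite e.
Qed.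

Lemma supp_trivial mu S : wt S = 0 -> supp mu S = 0.
Proof.
move=> e; rewrite /supp e /pairing; apply: (big_ind (fun x => x = 0)) => [|x y -> ->|p _];
  by rewrite ?mul0mx ?mxE ?minxx.
Qed.

(** Each vertex lies in its polytope, so the vertices of two data of the same
    polytope dominate each other for the order attached to p. *)
Lemma ggms_inj P mu mu' p : ggms A P mu -> ggms A P mu' ->
  mu (permW p) = mu' (permW p).
Proof.
move=> [V e] [V' e'].
have h m (Vm : isV A m) : polytope A m (m (permW p)).
  by move=> w ww; apply: (Vm.1) => //; apply: weyl_permW.
have h1 : polytope A mu' (mu (permW p)) by rewrite -e' e; apply: h.
have h2 : polytope A mu (mu' (permW p)) by rewrite -e e'; apply: h.
apply: (@pairing_segP p) => i; apply/eqP; rewrite eq_le.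
have /weyl_geP -> := h1 _ (weyl_permW p).
by have /weyl_geP -> := h2 _ (weyl_permW p).
Qed.

(** Lists the elements of s first, then all other letters. *)
Lemma flag_perm (s : seq 'I_l.+1) : uniq s ->
  exists p, forall (d : nat) k, (d <= size s)%N -> (p k < d)%N = (k \in take d s).
Proof.
move=> us; pose r := [seq k <- enum 'I_l.+1 | k \notin s].
have ur : uniq (s ++ r).
  rewrite cat_uniq us filter_uniq ?enum_uniq // andbT /=.
  by apply/hasPn => k; rewrite mem_filter => /andP[].
have mr k : k \in s ++ r.
  by rewrite mem_cat mem_filter mem_enum andbT; case: (k \in s).
have sr : size (s ++ r) = l.+1.
  rewrite -[RHS]card_ord cardE; apply/eqP.
  by rewrite -uniq_size_uniq ?enum_uniq // => k; rewrite mem_enum mr.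
have lt_r k : (index k (s ++ r) < l.+1)%N by rewrite -[X in (_ < X)%N]sr index_mem.
have inj_r : injective (fun k => Ordinal (lt_r k)).
  by move=> k k' /(congr1 val) /= e; rewrite -(nth_index k (mr k)) e nth_index.
exists (perm inj_r) => d k sd; rewrite permE /= -in_take //.
by rewrite take_cat; case: ltngtP sd => // -> _; rewrite subnn take0 cats0 take_size.
Qed.

Lemma exists_seg S : S != finset.set0 -> S != [set: 'I_l.+1]%SET ->
  exists p i, S = seg p i.
Proof.
move=> S0 ST; have [p hp] := flag_perm (enum_uniq (mem S)).
have hS : (0 < #|S| <= l)%N.
  rewrite card_gt0 S0 -ltnS -[X in (_ < X)%N]card_ord -finset.cardsT.
  by rewrite proper_card // finset.properT.
have hi : (#|S|.-1 < l)%N by lia.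
exists p, (Ordinal hi); apply/finset.setP => k; rewrite inE /=.
have := hp #|S| k; rewrite -cardE => /(_ (leqnn _)); rewrite cardE take_size mem_enum -cardE => <-.
by lia.
Qed.

Lemma swpE i k : swp i k = (if k == i :> nat then i.+1
   else if k == i.+1 :> nat then nat_of_ord i else k) :> nat.
Proof.
rewrite /swp; case: tpermP => [->|->|/eqP + /eqP +].
- by rewrite loE eqxx hiE.
- by rewrite loE hiE eqxx (gtn_eqF (ltnSn i)).
by rewrite !ord_eqE loE hiE => /negbTE-> /negbTE->.
Qed.

(** Apply the relation at a permutation that lists T first and then a, b, c, for the
    two simple reflections that permute the last three. *)
Lemma three_term mu T (a b c : 'I_l.+1) : isV A mu -> tropical_plucker A mu ->
  a \notin T -> b \notin T -> c \notin T -> (a < b)%N -> (b < c)%N ->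
  supp mu (b |: T) + supp mu (a |: (c |: T)) =
  Num.min (supp mu (a |: T) + supp mu (b |: (c |: T)))
          (supp mu (c |: T) + supp mu (a |: (b |: T))).
Proof.
move=> V TP aT bT cT ab bc.
have us : uniq (enum T ++ [:: a; b; c]).
  rewrite cat_uniq enum_uniq /= !mem_enum (negbTE aT) (negbTE bT) (negbTE cT) /=.
  by rewrite !inE !ord_eqE; lia.
have [p hp] := flag_perm us; set t := #|T|.
rewrite size_cat /= -cardE -/t in hp.
have h0 k : (p k < t)%N = (k \in T).
  by rewrite hp ?leq_addr // take_cat -cardE ltnn subnn take0 cats0 mem_enum.
have h1 k : (p k < t + 1)%N = (k \in T) || (k == a).
  rewrite hp ?leq_add // take_cat -cardE ltnNge leq_addr /= addKn /=.
  by rewrite mem_cat mem_enum !inE.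
have h2 k : (p k < t + 2)%N = [|| k \in T, k == a | k == b].
  rewrite hp ?leq_add // take_cat -cardE ltnNge leq_addr /= addKn /=.
  by rewrite mem_cat mem_enum !inE.
have h3 k : (p k < t + 3)%N = [|| k \in T, k == a, k == b | k == c].
  rewrite hp ?leq_add // take_cat -cardE ltnNge leq_addr /= addKn /=.
  by rewrite mem_cat mem_enum !inE.
have nab : (a == b) = false by rewrite ord_eqE ltn_eqF.
have nbc : (b == c) = false by rewrite ord_eqE ltn_eqF.
have nac : (a == c) = false by rewrite ord_eqE ltn_eqF // (ltn_trans ab).
have pa : p a = t :> nat.
  by have := h0 a; have := h1 a; rewrite eqxx orbT (negbTE aT); lia.
have pb : p b = t.+1 :> nat.
  by have := h1 b; have := h2 b; rewrite eqxx !orbT (negbTE bT) eq_sym nab; lia.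
have pc : p c = t.+2 :> nat.
  have := h2 c; have := h3 c.
  by rewrite eqxx !orbT (negbTE cT) ![c == _]eq_sym nac nbc; lia.
have tl : (t.+1 < l)%N by have := ltn_ord (p c); rewrite pc.
pose i := Ordinal (ltnW tl); pose j := Ordinal tl.
have ea : lo i = p a by apply: ord_inj; rewrite pa.
have eb : hi i = p b by apply: ord_inj; rewrite pb hiE.
have eb' : lo j = p b by apply: ord_inj; rewrite pb.
have ec : hi j = p c by apply: ord_inj; rewrite pc hiE.
have nij : i != j by rewrite ord_eqE /= ltn_eqF.
have Aij : A i j = - 1 by rewrite mxE (negbTE nij) /= eqxx.
have Aji : A j i = - 1 by rewrite mxE eq_sym (negbTE nij) /= eqxx orbT.
have shi : shorter A (permW p) (permW p *m refl R A i) by apply: (shorter_refl_r ab).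
have shj : shorter A (permW p) (permW p *m refl R A j) by apply: (shorter_refl_r bc).
have [/(_ Aij Aji)] := TP _ _ _ (weyl_permW p) nij shi shj.
rewrite !refl_permW -!permWM !Mdata_supp // => + _ _.
have seg_flag q (m : 'I_l) S :
    (forall k, (q k <= m)%N = (k \in S)) -> supp mu (seg q m) = supp mu S.
  by move=> h; congr supp; apply/finset.setP => k; rewrite inE h.
have in_flag (k x : 'I_l.+1) (d : nat) : p x = d :> nat -> (k == x) = (p k == d :> nat).
  by move=> <-; rewrite -ord_eqE (inj_eq perm_inj).
rewrite (seg_flag (p * swp i)%g i (b |: T)%SET) ?(seg_flag (p * swp j)%g j (a |: (c |: T))%SET)
  ?(seg_flag p i (a |: T)%SET) ?(seg_flag (p * swp i * swp j)%g j (b |: (c |: T))%SET)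
  ?(seg_flag (p * swp j * swp i)%g i (c |: T)%SET) ?(seg_flag p j (a |: (b |: T))%SET) // => k;
  rewrite ?permM ?swpE !inE ?(in_flag _ _ _ pa) ?(in_flag _ _ _ pb) ?(in_flag _ _ _ pc) -h0 /=;
  clear; repeat case: ifP; lia.
Qed.

End Weyl.

(** * The lowering operators on support functions *)

Section Lowering.
Context (R : realType) (l : nat).
Implicit Types (k : 'I_l.+1) (i j : 'I_l) (S T : {set 'I_l.+1}).
Implicit Types (mu : 'M[R]_l -> 'cV[R]_l) (M : {set 'I_l.+1} -> R).

Local Notation A := (cartanA l).
Local Notation permW := (@permW R l).

Definition init j : {set 'I_l.+1} := [set k : 'I_l.+1 | (k <= j)%N]%SET.

Definition swap i S : {set 'I_l.+1} := [set k | swp i k \in S]%SET.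

Definition lowered i (c : R) M S : R :=
  if (lo i \in S) && (hi i \notin S) then Num.min (M S) (M (swap i S) + c) else M S.

(** The constant M_(Lambda_i) - M_(s_i Lambda_i) - 1. *)
Definition lowering_const i M : R := M (init i) - M (swap i (init i)) - 1.

Lemma seg1 j : seg 1 j = init j.
Proof. by apply/finset.setP => k; rewrite !inE perm1. Qed.

Lemma seg_swp j : seg (swp j) j = swap j (init j).
Proof. by apply/finset.setP => k; rewrite !inE. Qed.

Lemma swap_loU j T : lo j \notin T -> hi j \notin T ->
  swap j (lo j |: T)%SET = (hi j |: T)%SET.
Proof.
move=> lT hT; apply/finset.setP => k; rewrite !inE /swp.
have lh := lo_hi j; have hl := lh; rewrite eq_sym in hl.
case: tpermP => [->|->|/eqP/negbTE-> /eqP/negbTE->] //.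
  by rewrite hl lh (negbTE lT) (negbTE hT).
by rewrite !eqxx.
Qed.

(** A set S that does not contain j without j + 1 is an initial segment of some
    permutation in which j + 1 comes before j: if j comes first, then S contains
    both letters or none, and they can be exchanged. *)
Lemma supp_unchanged mu mu' j S : isV A mu -> isV A mu' ->
  (forall p : 'S_l.+1, (p (hi j) < p (lo j))%N -> mu' (permW p) = mu (permW p)) ->
  ~~ ((lo j \in S) && (hi j \notin S)) -> supp mu' S = supp mu S.
Proof.
move=> V V' agr jS.
have [->|S0] := eqVneq S finset.set0; first by rewrite !supp_trivial ?wt0.
have [->|ST] := eqVneq S finset.setT; first by rewrite !supp_trivial ?wtT.
have [p [i Sp]] := exists_seg S0 ST.
suff [q lt_q ->] : exists2 q : 'S_l.+1, (q (hi j) < q (lo j))%N & S = seg q i.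
  by rewrite !supp_seg // agr.
have [h|h|/ord_inj/perm_inj/eqP] := ltngtP (p (hi j)) (p (lo j)).
- by exists p.
- exists (swp j * p)%g; first by rewrite !permM tpermL tpermR.
  rewrite Sp; apply/finset.setP => k; rewrite !inE permM.
  move: jS; rewrite Sp !inE => jS.
  by case: tpermP => [->|->|//]; lia.
- by rewrite eq_sym lo_hi.
Qed.

(** One step of the recursion: x and xa are the values of M at T + j and T + a + j,
    y and ya those at T + (j + 1) and T + a + (j + 1), a prime marks the lowered
    polytope, and m collects the terms that lowering leaves unchanged. *)
Lemma lowered_step (x x' xa xa' y ya m c : R) :
  y + xa = Num.min (x + ya) m -> y + xa' = Num.min (x' + ya) m ->
  x' = Num.min x (y + c) -> xa' = Num.min xa (ya + c).
Proof.
move=> e1 e2 e3; rewrite {x'}e3 in e2.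
have -> : xa = Num.min (x + ya) m - y by rewrite -e1; lra.
have -> : xa' = Num.min (Num.min x (y + c) + ya) m - y by rewrite -e2; lra.
by rewrite !minElt; repeat case: ifPn; rewrite -?leNgt; lra.
Qed.

(** Induction on the distance of T, the set S without j, from {1, ..., j - 1}.  A
    letter a > j + 1 of T is removed, or a missing letter a < j is added, by means
    of the three-term relation for the letters j, j + 1, a. *)
Lemma lowering_supp j (P P' : set 'cV[R]_l) mu mu' :
  lowering A j P P' -> ggms A P mu -> ggms A P' mu' ->
  mu' 1%:M = mu 1%:M - coroot R j /\
  supp mu' =1 lowered j (lowering_const j (supp mu)) (supp mu).
Proof.
case=> [[nu [gnu _ TPnu]] [nu' [gnu' _ TPnu']] [rho [rho' [grho grho' e1 agr]]]] gmu gmu'.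
have E p := ggms_inj p grho gmu; have E' p := ggms_inj p grho' gmu'.
have V := gmu.1; have V' := gmu'.1.
have e1' : mu' 1%:M = mu 1%:M - coroot R j by rewrite -permW1 -E -E' permW1.
split=> //; set c := lowering_const j _.
have agr' (p : 'S_l.+1) : (p (hi j) < p (lo j))%N -> mu' (permW p) = mu (permW p).
  move=> h; rewrite -E -E'; apply: agr; first exact: weyl_permW.
  rewrite refl_permW -permWM -{2}(mulKg (swp j) p) tpermV.
  by apply: shorter_tperm; rewrite ?hiE // !permM tpermL tpermR.
have unch S := supp_unchanged V V' agr' (S := S).
have plu T (a b d : 'I_l.+1) : a \notin T -> b \notin T -> d \notin T ->
    (a < b)%N -> (b < d)%N ->
  supp mu (b |: T) + supp mu (a |: (d |: T)) =
  Num.min (supp mu (a |: T) + supp mu (b |: (d |: T)))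
          (supp mu (d |: T) + supp mu (a |: (b |: T))).
  have e := eq_supp (fun p => ggms_inj p gmu gnu); rewrite !e.
  exact: three_term (gnu.1) TPnu.
have plu' T (a b d : 'I_l.+1) : a \notin T -> b \notin T -> d \notin T ->
    (a < b)%N -> (b < d)%N ->
  supp mu' (b |: T) + supp mu' (a |: (d |: T)) =
  Num.min (supp mu' (a |: T) + supp mu' (b |: (d |: T)))
          (supp mu' (d |: T) + supp mu' (a |: (b |: T))).
  have e := eq_supp (fun p => ggms_inj p gmu' gnu'); rewrite !e.
  exact: three_term (gnu'.1) TPnu'.
have lh := lo_hi j; have hl := lh; rewrite eq_sym in hl.
suff main T : lo j \notin T -> hi j \notin T -> supp mu' (lo j |: T) =
    Num.min (supp mu (lo j |: T)) (supp mu (hi j |: T) + c).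
  move=> S; rewrite /lowered; case: ifPn => [/andP[lS hS]|]; last exact: unch.
  rewrite -(finset.setD1K lS) main ?swap_loU // !inE ?eqxx ?hl ?(negbTE hS) //.
pose T0 : {set 'I_l.+1} := [set k : 'I_l.+1 | (k < j)%N]%SET.
(* distance of T from T0; it decreases along the recursion *)
pose d T : {set 'I_l.+1} := ((T :\: T0) :|: (T0 :\: T))%SET.
have [m] := ubnP #|d T|; elim: m T => // m IH T; rewrite ltnS => dT lT hT.
have smaller T' a : d T' = (d T :\ a)%SET -> a \in d T -> (#|d T'| < m)%N.
  by move=> -> ad; move: dT; rewrite [#|d T|](cardsD1 a) ad.
have [dT0|[a ad]] := finset.set_0Vmem (d T).
  have {smaller dT0} -> : T = T0.
    move/eqP: dT0; rewrite finset.setU_eq0 !finset.setD_eq0 => /andP[h1 h2].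
    by apply/eqP; rewrite finset.eqEsubset h1.
  have eI : (lo j |: T0)%SET = init j.
    by apply/finset.setP => k; rewrite !inE ord_eqE loE -leq_eqVlt.
  rewrite eI -swap_loU ?inE ?loE ?hiE ?ltnn // ?eI; last by rewrite ltnNge leqW.
  have -> : supp mu' (init j) = supp mu (init j) - 1.
    rewrite -seg1 !supp_seg // permW1 e1' pairingB -fweight_permW permW1 invmx1 mulmx1.
    by rewrite !pairing_fweight mxE !eqxx.
  by rewrite /c /lowering_const minElt; case: ifPn; rewrite -?leNgt; lra.
move: (ad); rewrite !inE => /orP[] /andP[aT0 aT].
- have aj : (hi j < a)%N.
    move: aT0; rewrite -leqNgt leq_eqVlt hiE => /orP[/eqP e|].
      by move: lT; rewrite (_ : lo j = a) ?aT //; apply: ord_inj.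
    rewrite leq_eqVlt => /orP[/eqP e|//].
    by move: hT; rewrite (_ : hi j = a) ?aT //; apply: ord_inj; rewrite hiE.
  pose U := (T :\ a)%SET.
  have eT : T = (a |: U)%SET by rewrite finset.setD1K.
  have lU : lo j \notin U by rewrite !inE (negbTE lT) andbF.
  have hU : hi j \notin U by rewrite !inE (negbTE hT) andbF.
  have aU : a \notin U by rewrite !inE eqxx.
  have QU : supp mu' (lo j |: U) = Num.min (supp mu (lo j |: U)) (supp mu (hi j |: U) + c).
    apply: IH lU hU; apply: (smaller _ a) => //.
    apply/finset.setP => k; rewrite !inE; case: eqVneq => [->|//]; by rewrite (negbTE aT0) !andbF.
  have ljh : (lo j < hi j)%N by rewrite hiE.
  have := plu _ _ _ _ lU hU aU ljh aj; have := plu' _ _ _ _ lU hU aU ljh aj.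
  rewrite -eT => h' h; apply: lowered_step h _ QU.
  move: h'; rewrite (unch (hi j |: U)%SET) ?(unch (hi j |: T)%SET) ?(unch T)
    ?(unch (lo j |: (hi j |: U))%SET) // ?inE ?eqxx ?(negbTE lT) ?orbT ?andbF //.
- have aj : (a < lo j)%N by [].
  have al : lo j \notin (a |: T)%SET by rewrite !inE negb_or lT andbT ord_eqE gtn_eqF.
  have ah : hi j \notin (a |: T)%SET.
    by rewrite !inE negb_or hT andbT ord_eqE gtn_eqF // hiE ltnS ltnW.
  have QT : supp mu' (lo j |: (a |: T)) =
      Num.min (supp mu (lo j |: (a |: T))) (supp mu (hi j |: (a |: T)) + c).
    apply: IH al ah; apply: (smaller _ a) => //.
    apply/finset.setP => k; rewrite !inE; case: eqVneq => [->|//]; by rewrite aT.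
  have ljh : (lo j < hi j)%N by rewrite hiE.
  have := plu _ _ _ _ aT0 lT hT aj ljh; have := plu' _ _ _ _ aT0 lT hT aj ljh.
  rewrite (unch (a |: (hi j |: T))%SET) ?(unch (a |: T)%SET)
    ?(unch (lo j |: (hi j |: T))%SET) ?(unch (hi j |: T)%SET) //;
    try by rewrite !inE ?eqxx ?orbT ?andbF //; move: al; rewrite !inE => /negbTE->.
  rewrite ![(a |: (_ |: T))%SET]finset.setUCA => h' h.
  by apply: (lowered_step _ _ QT); [move: h|move: h']; rewrite addrC => ->;
    rewrite minC [X in Num.min X _]addrC.
Qed.

End Lowering.

(** * The diagram automorphism *)

Section Omega.
Context (R : realType) (n : nat).
Local Notation l := (n + n)%N.
Implicit Types (p q : 'S_l.+1) (k : 'I_l.+1) (i : 'I_l) (S T : {set 'I_l.+1}).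
Implicit Types (mu : 'M[R]_l -> 'cV[R]_l).

Local Notation A := (cartanA l).
Local Notation permW := (@permW R l).
Local Notation wt := (@wt R l).
Local Notation eps := (@eps R l).
Local Notation supp := (@supp R l).

(** The automorphism maps eps_k to the opposite of the reversed weight, and all
    weights sum to 0; so it acts on sets by reversal and complement. *)
Definition omega_set S : {set 'I_l.+1} := [set k : 'I_l.+1 | rev_ord k \notin S]%SET.

Definition omega_perm p : 'S_l.+1 :=
  (perm (@rev_ord_inj l.+1) * p * perm (@rev_ord_inj l.+1))%g.

Definition centrally_symmetric p := forall k, p (rev_ord k) = rev_ord (p k).

Lemma omega_setK : involutive omega_set.
Proof. by move=> S; apply/finset.setP => k; rewrite !inE rev_ordK negbK. Qed.

Lemma omega_permE p k : omega_perm p k = rev_ord (p (rev_ord k)).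
Proof. by rewrite !permM !permE. Qed.

Lemma eps_rev k i : eps (rev_ord k) 0 (rev_ord i) = - eps k 0 i.
Proof.
rewrite !mxE opprB /=; have := ltn_ord k; have := ltn_ord i => h1 h2.
by congr (_%:R - _%:R); congr nat_of_bool; apply/eqP/eqP; lia.
Qed.

Lemma pairing_omega S (h : 'cV[R]_l) :
  pairing (wt S) (omega_h h) = pairing (wt (omega_set S)) h.
Proof.
have eps_omega k : pairing (eps k) (omega_h h) = - pairing (eps (rev_ord k)) h.
  rewrite /pairing !mxE -sumrN [RHS](reindex_inj rev_ord_inj) /=.
  by apply: eq_bigr => i _; rewrite eps_rev mulNr opprK [X in _ * X = _]mxE.
have pw T (g : 'cV[R]_l) : pairing (wt T) g = \sum_(k in T) pairing (eps k) g.
  by rewrite /pairing mulmx_suml summxE.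
rewrite pw (eq_bigr _ (fun k _ => eps_omega k)) sumrN.
rewrite (_ : omega_set S = (~: (@rev_ord l.+1 @: S))%SET); last first.
  apply/finset.setP => k; rewrite !inE -{2}(rev_ordK k) finset.mem_imset //.
  exact: rev_ord_inj.
rewrite wtC /pairing mulNmx [RHS]mxE -/(pairing _ _) pw; congr (- _).
by rewrite big_imset //= => x y _ _; apply: rev_ord_inj.
Qed.

Lemma omega_permW p : omega_W (permW p) = permW (omega_perm p).
Proof.
apply: mx_epsP => k; rewrite eps_permW omega_permE; apply/rowP => i.
rewrite -[X in _ = eps _ 0 X]rev_ordK eps_rev -eps_permW !mxE -sumrN.
rewrite (reindex_inj rev_ord_inj) /=; apply: eq_bigr => m _.
by rewrite -[k in LHS]rev_ordK eps_rev mulNr [X in _ * X]mxE rev_ordK.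
Qed.

Lemma WomegaP (w : 'M[R]_l) :
  Womega w <-> exists2 p, w = permW p & centrally_symmetric p.
Proof.
split=> [[/weylP[p ->]]|[p -> sp]].
  rewrite omega_permW => /permW_inj e; exists p => // k.
  by rewrite -{1}e omega_permE rev_ordK.
split; first exact: weyl_permW.
by rewrite omega_permW; congr permW; apply/permP => k; rewrite omega_permE sp rev_ordK.
Qed.

Lemma supp_ge mu S x : (forall p, x <= pairing (wt S) (mu (permW p))) -> x <= supp mu S.
Proof. by move=> h; apply: le_bigmin => [|p _] //; rewrite -permW1. Qed.

Lemma isVomega_supp mu : isVomega mu -> forall S, supp mu (omega_set S) = supp mu S.
Proof.
move=> [_ sym] S.
have le T : supp mu (omega_set T) <= supp mu T.
  apply: supp_ge => p; rewrite -(sym _ (weyl_permW R p)) pairing_omega omega_permW.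
  exact: supp_le.
by apply/eqP; rewrite eq_le le -{1}(omega_setK S) le.
Qed.

Lemma supp_isVomega mu : isV A mu -> (forall S, supp mu (omega_set S) = supp mu S) ->
  isVomega mu.
Proof.
move=> V sym; split=> // w /weylP[p ->]; rewrite omega_permW.
apply: (@pairing_segP _ _ p) => i; rewrite pairing_omega.
have e : omega_set (seg p i) = seg (omega_perm p) (rev_ord i).
  apply/finset.setP => k; rewrite !inE omega_permE /=.
  by have := ltn_ord i; have := ltn_ord (p (rev_ord k)); lia.
by rewrite {1}e -!supp_seg // -e sym.
Qed.

End Omega.

(** * The three middle letters *)

Section Middle.
Context (R : realType) (n : nat) (j : 'I_n) (hj : j.+1 = n).
Local Notation l := (n + n)%N.
Implicit Types (k : 'I_l.+1) (S : {set 'I_l.+1}) (M : {set 'I_l.+1} -> R).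
Implicit Types (u v w : bool).

Local Notation i1 := (idx j).
Local Notation i2 := (idx_omega j).
Local Notation ka := (lo i1).
Local Notation kb := (hi i1).
Local Notation kc := (hi i2).

Lemma idx_omegaE : i2 = n :> nat.
Proof. by have := hj; rewrite /=; lia. Qed.

Lemma lo_idx_omega : lo i2 = kb.
Proof. by apply: ord_inj; rewrite hiE loE idx_omegaE. Qed.

Lemma letters : [/\ ka = n.-1 :> nat, kb = n :> nat & kc = n.+1 :> nat].
Proof. by rewrite !hiE idx_omegaE loE; have := hj; split=> //=; lia. Qed.

Lemma letter_neq : [/\ (ka == kb) = false, (ka == kc) = false & (kb == kc) = false].
Proof. by rewrite !ord_eqE; case: letters => -> -> ->; have := hj; split; lia. Qed.

Lemma rev_letters : [/\ rev_ord ka = kc, rev_ord kb = kb & rev_ord kc = ka].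
Proof.
have [ea eb ec] := letters.
have revE (m : nat) (k : 'I_m) : rev_ord k = (m - k.+1)%N :> nat by [].
by split; apply: ord_inj; rewrite revE ?ea ?eb ?ec; have := hj; clear; lia.
Qed.

(** Prescribes which of the three middle letters belong to the set.  Both
    transpositions and the automorphism then act on the three booleans. *)
Definition put S u v w : {set 'I_l.+1} :=
  [set k | if k == ka then u else if k == kb then v else if k == kc then w
           else k \in S]%SET.

Lemma put_id S : put S (ka \in S) (kb \in S) (kc \in S) = S.
Proof.
by apply/finset.setP => k; rewrite inE; repeat case: eqP => [->//|_].
Qed.

Lemma in_put S u v w :
  [/\ (ka \in put S u v w) = u, (kb \in put S u v w) = v & (kc \in put S u v w) = w].
Proof.
have [ab ac bc] := letter_neq.
by rewrite !inE !eqxx ![kb == _]eq_sym ![kc == _]eq_sym ab ac bc.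
Qed.

Lemma swap1_put S u v w : swap i1 (put S u v w) = put S v u w.
Proof.
have [ab ac bc] := letter_neq; apply/finset.setP => k; rewrite !inE /swp.
case: tpermP => [->|->|/eqP/negbTE-> /eqP/negbTE->] //;
by rewrite !eqxx // eq_sym ab.
Qed.

Lemma swap2_put S u v w : swap i2 (put S u v w) = put S u w v.
Proof.
have [ab ac bc] := letter_neq; apply/finset.setP => k; rewrite !inE /swp lo_idx_omega.
case: tpermP => [->|->|/eqP/negbTE-> /eqP/negbTE->] //;
by rewrite !eqxx // ![kb == _]eq_sym ![kc == _]eq_sym ab ac bc.
Qed.

Lemma omega_put S u v w : omega_set (put S u v w) = put (omega_set S) (~~ w) (~~ v) (~~ u).
Proof.
have [ra rb rc] := rev_letters; have [ab ac bc] := letter_neq.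
apply/finset.setP => k; rewrite !inE.
rewrite -![rev_ord k == _](inj_eq rev_ord_inj) rev_ordK ra rb rc.
have [->|_] := eqVneq k ka; first by rewrite ac ab.
have [->|_] := eqVneq k kb; first by rewrite bc.
by case: ifP.
Qed.

Lemma init_put : init i1 = put (init i1) true false false /\
  init i2 = put (init i1) true true false.
Proof.
have [ea eb ec] := letters.
have e1 : i1 = n.-1 :> nat by have := hj; rewrite /=; lia.
have n0 : (0 < n)%N by have := hj; lia.
split; apply/finset.setP => k; rewrite !inE !ord_eqE ea eb ec ?idx_omegaE e1;
  repeat case: eqP => [->|?]; lia.
Qed.

Lemma lowered1_put c M S u v w : lowered i1 c M (put S u v w) =
  if u && ~~ v then Num.min (M (put S u v w)) (M (put S v u w) + c) else M (put S u v w).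
Proof. by rewrite /lowered swap1_put; have [-> ->] := in_put S u v w. Qed.

Lemma lowered2_put c M S u v w : lowered i2 c M (put S u v w) =
  if v && ~~ w then Num.min (M (put S u v w)) (M (put S u w v) + c) else M (put S u v w).
Proof. by rewrite /lowered swap2_put lo_idx_omega; have [_ -> ->] := in_put S u v w. Qed.

(** The effect of f_n f_(n+1)^2 f_n on support functions of invariant polytopes. *)
Definition omega_lowered (c : R) M S u v w : R :=
  let m u' v' w' := M (put S u' v' w') in
  match u, v, w with
  | true, false, false => Num.min (m true false false)
      (Num.min (m false true false + c) (m false false true + 2 * c))
  | true, true, false => Num.min (m true true false)
      (Num.min (m true false true + c) (m false true true + 2 * c))
  | false, true, false => Num.min (m false true false) (m false false true + c)
  | true, false, true => Num.min (m true false true) (m false true true + c)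
  | _, _, _ => m u v w
  end.

Lemma lowering_const1E M : lowering_const i1 M =
  M (put (init i1) true false false) - M (put (init i1) false true false) - 1.
Proof. by have [I1 _] := init_put; rewrite /lowering_const -(swap1_put _ true false false) -I1. Qed.

Lemma lowering_const2E M : lowering_const i2 M =
  M (put (init i1) true true false) - M (put (init i1) true false true) - 1.
Proof. by have [_ I2] := init_put; rewrite /lowering_const -(swap2_put _ true true false) -I2. Qed.

(** Write M_1, M_2, M_3 for the values at {1..n-1} with one middle letter added.
    Invariance identifies the values with two letters added with these, and the
    three-term relation becomes 2 M_2 = M_1 + M_3.  Hence the second operator has
    the constant c + 1, the third and the fourth have the constant c. *)
Lemma lowered_compose M0 M1 M2 M3 M4 S u v w :
  (forall T, M0 (omega_set T) = M0 T) ->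
  (let m u' v' w' := M0 (put (init i1) u' v' w') in
   m false true false + m true false true =
   Num.min (m true false false + m false true true) (m false false true + m true true false)) ->
  M1 =1 lowered i1 (lowering_const i1 M0) M0 -> M2 =1 lowered i2 (lowering_const i2 M1) M1 ->
  M3 =1 lowered i2 (lowering_const i2 M2) M2 -> M4 =1 lowered i1 (lowering_const i1 M3) M3 ->
  M4 (put S u v w) = omega_lowered (lowering_const i1 M0) M0 S u v w.
Proof.
move=> sym tp e1 e2 e3 e4; have [I1 I2] := init_put.
have oI : omega_set (init i1) = init i2.
  apply/finset.setP => k; rewrite !inE idx_omegaE /=.
  by have := ltn_ord k; have := hj; lia.
set c := lowering_const i1 M0.
have symI u' v' w' : M0 (put (init i1) (~~ w') (~~ v') (~~ u')) = M0 (put (init i1) u' v' w').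
  rewrite -[RHS]sym omega_put oI I2; congr M0; apply/finset.setP => k.
  by rewrite !inE; repeat case: ifP.
have s1 := symI true false false; have s2 := symI false true false.
have s3 := symI false false true; rewrite /= in s1 s2 s3.
have dc : c = M0 (put (init i1) true false false) - M0 (put (init i1) false true false) - 1.
  exact: lowering_const1E.
rewrite /= in tp.
have d1 : lowering_const i2 M1 = c + 1.
  rewrite lowering_const2E !e1 !lowered1_put /= -/c; move: tp dc; rewrite s1 s2 s3.
  by rewrite !minElt; repeat case: ifPn; rewrite -?leNgt; lra.
have d2 : lowering_const i2 M2 = c.
  rewrite lowering_const2E !e2 !lowered2_put /= !e1 !lowered1_put /= d1 -/c.
  move: tp dc; rewrite s1 s2 s3.
  by rewrite !minElt; repeat case: ifPn; rewrite -?leNgt; lra.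
(* the two middle operators together act as one with the smaller constant *)
have e23 T u' v' w' : M3 (put T u' v' w') = if v' && ~~ w' then
    Num.min (M1 (put T u' v' w')) (M1 (put T u' w' v') + c) else M1 (put T u' v' w').
  rewrite e3 lowered2_put !e2 !lowered2_put d1 d2 -/c.
  case: v'; case: w' => //=; rewrite -minA; congr Num.min.
  by rewrite minElt; case: ifPn => //; lra.
have d3 : lowering_const i1 M3 = c.
  rewrite lowering_const1E !e23 /= !e1 !lowered1_put /= -/c; move: tp dc; rewrite s1 s2 s3; clear.
  by rewrite !minElt; repeat case: ifPn; rewrite -?leNgt; lra.
rewrite e4 lowered1_put !e23 !e1 !lowered1_put d3 -/c; clear.
by case: u; case: v; case: w => //=; rewrite !minElt; repeat case: ifPn; rewrite -?leNgt; lra.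
Qed.

End Middle.

(** * The lowered polytope satisfies the conditions *)

Section LoweredPolytope.
Context (R : realType) (n : nat) (j : 'I_n) (hj : j.+1 = n).
Local Notation l := (n + n)%N.
Implicit Types (p : 'S_l.+1) (k : 'I_l.+1) (i : 'I_l) (S T : {set 'I_l.+1}).
Implicit Types (mu : 'M[R]_l -> 'cV[R]_l) (h : 'cV[R]_l).
Implicit Types (u v w : bool) (c : R).

Local Notation A := (cartanA l).
Local Notation permW := (@permW R l).
Local Notation wt := (@wt R l).
Local Notation eps := (@eps R l).
Local Notation supp := (@supp R l).
Local Notation i1 := (idx j).
Local Notation i2 := (idx_omega j).
Local Notation ka := (lo i1).
Local Notation kb := (hi i1).
Local Notation kc := (hi i2).
Local Notation put := (put j).

Lemma three_term_put mu S : isV A mu -> tropical_plucker A mu ->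
  supp mu (put S false true false) + supp mu (put S true false true) =
  Num.min (supp mu (put S true false false) + supp mu (put S false true true))
          (supp mu (put S false false true) + supp mu (put S true true false)).
Proof.
move=> V TP; pose T := put S false false false.
have [aT bT cT] : [/\ ka \notin T, kb \notin T & kc \notin T].
  by have [-> -> ->] := in_put hj S false false false.
have [ab bc] : (ka < kb)%N /\ (kb < kc)%N.
  by have [-> -> ->] := letters hj; split; lia.
have [nab nac nbc] := letter_neq hj.
have := three_term V TP aT bT cT ab bc.
have e u v w : put S u v w = ((if u then [set ka] else finset.set0) :|:
    ((if v then [set kb] else finset.set0) :|:
     ((if w then [set kc] else finset.set0) :|: T)))%SET.
  apply/finset.setP => k; rewrite !inE.
  have [->|ka'] := eqVneq k ka.
    by case: u; rewrite ?inE ?eqxx //=; case: v; case: w; rewrite ?inE ?nab ?nac.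
  have [->|kb'] := eqVneq k kb.
    by case: v; case: u; case: w; rewrite ?inE ?eqxx ?nbc //= eq_sym nab.
  have [->|kc'] := eqVneq k kc.
    by case: w; case: u; case: v; rewrite ?inE ?eqxx //= ![kc == _]eq_sym ?nac ?nbc.
  by case: u; case: v; case: w; rewrite ?inE ?(negbTE ka') ?(negbTE kb') ?(negbTE kc').
by rewrite !e !finset.set0U.
Qed.

Lemma lowering_omega_supp P P' mu mu' :
  isMVomega P -> ggms A P mu -> lowering_omega j P P' -> ggms A P' mu' ->
  [/\ forall S, supp mu (omega_set S) = supp mu S,
      mu' 1%:M = mu 1%:M - coroot_omega R j &
      forall S u v w, supp mu' (put S u v w) =
        omega_lowered j (lowering_const i1 (supp mu)) (supp mu) S u v w].
Proof.
move=> [[nu [gnu _ TP]] [nu' gnu' Vnu']] gmu; rewrite /lowering_omega hj eqxx.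
move=> [P1 [P2 [P3 [f1 f2 f3 f4]]]] gmu'.
have sym S : supp mu (omega_set S) = supp mu S.
  by rewrite !(eq_supp (fun p => ggms_inj p gmu gnu')) isVomega_supp.
have [_ [mu1 [gmu1 _ _]] _] := f1; have [_ [mu2 [gmu2 _ _]] _] := f2.
have [_ [mu3 [gmu3 _ _]] _] := f3.
have [o1 e1] := lowering_supp f1 gmu gmu1.
have [o2 e2] := lowering_supp f2 gmu1 gmu2.
have [o3 e3] := lowering_supp f3 gmu2 gmu3.
have [o4 e4] := lowering_supp f4 gmu3 gmu'.
split=> //.
  rewrite o4 o3 o2 o1 /coroot_omega hj eqxx scaler_nat mulr2n.
  by apply/colP => k; rewrite !mxE; lra.
move=> S u v w; apply: (lowered_compose hj) e1 e2 e3 e4 => //.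
rewrite /= !(eq_supp (fun p => ggms_inj p gmu gnu)).
exact: three_term_put gnu.1 TP.
Qed.

Lemma pairing_root i h : pairing (Defs.root R A i) h =
  pairing (eps (lo i)) h - pairing (eps (hi i)) h.
Proof. by rewrite root_eps /pairing mulmxBl [LHS]mxE [X in _ + X]mxE. Qed.

Lemma pairing_sigma S i c h : pairing (wt S) (sigma i c h) =
  pairing (wt S) h +
  ((lo i \in S)%:R - (hi i \in S)%:R) * (c - pairing (Defs.root R A i) h).
Proof.
rewrite /sigma pairingD pairingZ pairing_coroot /refl mulmxBl mul1mx pairingB.
rewrite -mulmxA [X in coroot R i *m X](_ : _ = (pairing (Defs.root R A i) h)%:M).
  by rewrite mul_mx_scalar pairingZ pairing_coroot; lra.
by apply/matrixP => x y; rewrite !ord1 [RHS]mxE eqxx mulr1n.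
Qed.

(** The part of <wt S, h> that does not involve the three middle letters; it is
    invariant under sigma and tau. *)
Definition rest S h : R := pairing (wt (put S false false false)) h.
Definition coord k h : R := pairing (eps k) h.

Lemma pairing_put S u v w h : pairing (wt (put S u v w)) h =
  rest S h + u%:R * coord ka h + v%:R * coord kb h + w%:R * coord kc h.
Proof.
have [nab nac nbc] := letter_neq hj.
have pw T : pairing (wt T) h = \sum_k (k \in T)%:R * coord k h.
  rewrite /pairing mulmx_suml summxE big_mkcond; apply: eq_bigr => k _.
  by case: ifP; rewrite ?mul1r ?mul0r.
rewrite /rest !pw.
have pick (x : R) a : x * coord a h = \sum_k (x * (k == a)%:R) * coord k h.
  rewrite (bigD1 a) //= eqxx mulr1 big1 ?addr0 // => k /negbTE ->.
  by rewrite mulr0 mul0r.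
rewrite !pick -!big_split; apply: eq_bigr => k _ /=; rewrite -!mulrDl; congr (_ * _).
rewrite !inE; have [->|_] := eqVneq k ka; first by rewrite nab nac /=; lra.
have [->|_] := eqVneq k kb; first by rewrite nbc /=; lra.
by case: eqVneq => _ /=; lra.
Qed.

Lemma coord_sigma k i c h : coord k (sigma i c h) = coord k h +
  ((lo i == k)%:R - (hi i == k)%:R) * (c - (coord (lo i) h - coord (hi i) h)).
Proof. by rewrite /coord -!wt1 pairing_sigma !inE pairing_root -!wt1. Qed.

Lemma sigma1_coord S c h : let h' := sigma i1 c h in
  [/\ rest S h' = rest S h, coord ka h' = coord kb h + c,
      coord kb h' = coord ka h - c & coord kc h' = coord kc h].
Proof.
have [nab nac nbc] := letter_neq hj.
rewrite /= !coord_sigma !eqxx nab ![kb == _]eq_sym nab nac [kc == _]eq_sym nbc.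
rewrite /rest pairing_sigma; have [-> -> _] := in_put hj S false false false.
by split; rewrite /=; lra.
Qed.

Lemma sigma2_coord S c h : let h' := sigma i2 c h in
  [/\ rest S h' = rest S h, coord ka h' = coord ka h,
      coord kb h' = coord kc h + c & coord kc h' = coord kb h - c].
Proof.
have [nab nac nbc] := letter_neq hj.
rewrite /= !coord_sigma (lo_idx_omega hj) !eqxx ![kc == _]eq_sym nac nbc [kb == ka]eq_sym nab.
rewrite /rest pairing_sigma (lo_idx_omega hj); have [_ -> ->] := in_put hj S false false false.
by split; rewrite /=; lra.
Qed.

Lemma refl_omega_permW : refl_omega R j = permW (tperm ka kc).
Proof.
have [nab nac nbc] := letter_neq hj.
rewrite /refl_omega hj eqxx !refl_permW -!permWM /swp (lo_idx_omega hj); congr permW.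
rewrite -{1}tpermV -mulgA -conjgE tpermJ tpermR tpermD //.
  by rewrite nac.
by rewrite nbc.
Qed.

(** A centrally symmetric permutation fixes the middle letter b and puts a and c in
    opposite positions, and b lies in the segment iff the segment contains more
    than half of the letters. *)
Lemma seg_letters p i : centrally_symmetric p -> let S := seg p i in
  (kb \in S -> (ka \in S) || (kc \in S)) /\ (ka \in S -> kc \in S -> kb \in S).
Proof.
move=> sp; have [ra rb rc] := rev_letters hj.
have eb := sp kb; have ec := sp ka; rewrite rb in eb; rewrite ra in ec.
move/(congr1 val): eb; move/(congr1 val): ec; rewrite /= !inE.
by have := ltn_ord (p ka); have := ltn_ord (p kb); lia.
Qed.

Lemma polytope_tildeP mu h : isV A mu -> polytope_tilde mu h <->
  forall p i, centrally_symmetric p -> supp mu (seg p i) <= pairing (wt (seg p i)) h.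
Proof.
move=> V; split=> [H p i sp|H w /WomegaP[p -> sp]].
  by rewrite supp_seg //; apply: (iffLR (weyl_geP _ _ _) (H _ _)); apply/WomegaP; exists p.
by apply/weyl_geP => i; rewrite -supp_seg // H.
Qed.

(** The six patterns are those allowed by [seg_letters]. *)
Lemma polytope_tilde_put mu h : isV A mu ->
  (forall S, let r := rest S h in
   let a := coord ka h in let b := coord kb h in let d := coord kc h in
   [/\ supp mu (put S false false false) <= r,
       supp mu (put S false false true) <= r + d,
       supp mu (put S false true true) <= r + b + d &
       supp mu (put S true true true) <= r + a + b + d] /\
   (supp mu (put S true false false) <= r + a /\
    supp mu (put S true true false) <= r + a + b)) ->
  polytope_tilde mu h.
Proof.
move=> V H; apply/polytope_tildeP => // p i sp.
have [h1 h2] := seg_letters i sp; have [[H1 H2 H3 H4] [H5 H6]] := H (seg p i).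
rewrite -(put_id j (seg p i)) pairing_put; move: h1 h2.
case: (ka \in _); case: (kb \in _); case: (kc \in _) => h1 h2; rewrite /=; lra.
Qed.

Lemma supp_put_bounds mu p S : let h := mu (permW p) in let r := rest S h in
   let a := coord ka h in let b := coord kb h in let d := coord kc h in
   [/\ supp mu (put S false false false) <= r,
       supp mu (put S false false true) <= r + d,
       supp mu (put S false true true) <= r + b + d &
       supp mu (put S true true true) <= r + a + b + d] /\
   [/\ supp mu (put S true false false) <= r + a,
       supp mu (put S true true false) <= r + a + b,
       supp mu (put S false true false) <= r + b &
       supp mu (put S true false true) <= r + a + d].
Proof.
have H u v w : supp mu (put S u v w) <= _ := supp_le mu p _.
by split; split; apply: le_trans (H _ _ _) _; rewrite pairing_put /=; lra.
Qed.

Lemma sym_tperm p : centrally_symmetric p -> centrally_symmetric (tperm ka kc * p)%g.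
Proof.
have [ra rb rc] := rev_letters hj.
move=> sp k; rewrite !permM -sp; congr (p _).
have [->|na] := eqVneq k ka; first by rewrite tpermL ra rc tpermR.
have [->|nc] := eqVneq k kc; first by rewrite tpermR ra rc tpermL.
rewrite [in RHS]tpermD ?(eq_sym _ k) // tpermD //.
  by rewrite -rc (inj_eq rev_ord_inj) eq_sym.
by rewrite -ra (inj_eq rev_ord_inj) eq_sym.
Qed.

Lemma seg_tperm (a b : 'I_l.+1) p i :
  seg (tperm a b * p)%g i = [set k | tperm a b k \in seg p i]%SET.
Proof. by apply/finset.setP => k; rewrite !inE permM. Qed.

Lemma shorter_tperm_desc p (a b : 'I_l.+1) : (a < b)%N -> (p b < p a)%N ->
  shorter A (permW (tperm a b * p)) (permW p).
Proof.
move=> ab pba; rewrite -{2}(mulKg (tperm a b) p) tpermV.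
by apply: shorter_tperm => //; rewrite !permM tpermL tpermR.
Qed.

Lemma shorter_tpermK p (a b : 'I_l.+1) : (a < b)%N -> (p a < p b)%N ->
  shorter A (permW (tperm a b * (tperm a b * p))) (permW (tperm a b * p)).
Proof. by move=> ab pab; rewrite mulgA tperm2 mul1g; apply: shorter_tperm. Qed.

Lemma ltn_letters : [/\ (ka < kb)%N, (kb < kc)%N & (ka < kc)%N].
Proof. by have [-> -> ->] := letters hj; split; lia. Qed.

Lemma Womega_minusP p : centrally_symmetric p ->
  Womega_minus j (permW p) <-> (p kc < p ka)%N.
Proof.
have [_ _ ac] := ltn_letters; have [_ nac _] := letter_neq hj => sp.
rewrite /Womega_minus /= refl_omega_permW -permWM; split=> [[_ sh]|pca]; last first.
  by split; [apply/WomegaP; exists p | apply: shorter_tperm_desc].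
case: ltngtP => // [pac|/ord_inj/perm_inj/eqP]; last by rewrite eq_sym nac.
by case: (shorter_asym sh); apply: shorter_tperm.
Qed.

(** If p itself has a before c, then the segment contains both letters or none, and
    exchanging them leads to an element of the minus part with the same segment. *)
Lemma supp_Womega_minus mu mu1 p i : isV A mu -> isV A mu1 ->
  (forall x, Womega_minus j x -> mu1 x = mu x) -> centrally_symmetric p ->
  ~~ ((ka \in seg p i) && (kc \notin seg p i)) ->
  supp mu1 (seg p i) = supp mu (seg p i).
Proof.
move=> V V1 H sp bits; have [_ nac _] := letter_neq hj.
case: (ltngtP (p ka) (p kc)) => [pac|pca|/ord_inj/perm_inj/eqP]; last by rewrite nac.
  have -> : seg p i = seg (tperm ka kc * p)%g i.
    rewrite seg_tperm; apply/finset.setP => k; move: bits; rewrite !inE.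
    by case: tpermP => [->|->|//]; lia.
  rewrite !supp_seg // H //; apply/Womega_minusP; first exact: sym_tperm.
  by rewrite !permM tpermL tpermR.
by rewrite !supp_seg // H //; apply/Womega_minusP.
Qed.

Section Conditions.
Context (mu mu' : 'M[R]_l -> 'cV[R]_l).
Context (V : isV A mu) (V' : isV A mu').
Context (Vomega : isVomega mu).
Context (mu'1 : mu' 1%:M = mu 1%:M - coroot_omega R j).
Let c := lowering_const i1 (supp mu).
Context (low : forall S u v w,
  supp mu' (put S u v w) = omega_lowered j c (supp mu) S u v w).

Lemma isVomega_lowered : isVomega mu'.
Proof.
apply: supp_isVomega => // S; rewrite -(put_id j S) (omega_put hj) !low.
have e u v w : supp mu (put (omega_set S) u v w) = supp mu (put S (~~ w) (~~ v) (~~ u)).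
  by rewrite -[RHS](isVomega_supp Vomega) (omega_put hj) !negbK.
by case: (ka \in S); case: (kb \in S); case: (kc \in S); rewrite /= !e.
Qed.

(** Invariance of the vertex gives <alpha_n, mu_w> = <alpha_(n+1), mu_w>, so that
    the hypothesis of (v) controls both differences. *)
Lemma coord_sym p : centrally_symmetric p -> let h := mu (permW p) in
  coord ka h - coord kb h = coord kb h - coord kc h.
Proof.
move=> sp /=; have [ra rb rc] := rev_letters hj.
have [_ /(_ _ (weyl_permW R p))] := Vomega.
have [_ ->] : Womega (permW p) by apply/WomegaP; exists p.
have e k : coord k (omega_h (mu (permW p))) = - coord (rev_ord k) (mu (permW p)).
  rewrite /coord -wt1 pairing_omega (_ : omega_set _ = ~: [set rev_ord k])%SET.
    by rewrite wtC wt1 /pairing mulNmx mxE.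
  by apply/finset.setP => m; rewrite !inE -(inj_eq rev_ord_inj) rev_ordK.
move=> eh; have := e ka; have := e kb; have := e kc.
by rewrite eh ra rb rc; lra.
Qed.

Lemma low_le S u v w : supp mu' (put S u v w) <= supp mu (put S u v w).
Proof. by rewrite low; case: u; case: v; case: w; rewrite /= ?ge_min ?lexx. Qed.

Lemma lowered_conditions : conditions j mu c mu'.
Proof.
split=> //.
- move=> x xm; have [/WomegaP[p xp sp] _] := xm.
  rewrite xp in xm *; move/Womega_minusP: xm => /(_ sp) pca.
  apply: (@pairing_segP _ _ p) => i; rewrite -!supp_seg // -(put_id j (seg p i)).
  have [] := seg_letters i sp; have : ka \in seg p i -> kc \in seg p i.
    by rewrite !inE; lia.
  rewrite low; case: (ka \in _); case: (kb \in _); case: (kc \in _) => // h1 h2 h3;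
    first [by have := h1 isT|by have := h2 isT|by have := h3 isT isT].
- move=> x [/WomegaP[p -> sp] _]; apply: polytope_tilde_put => // S /=.
  have [[? ? ? ?] [? ? ? ?]] := supp_put_bounds mu p S.
  by split; split; apply: le_trans (low_le _ _ _ _) _.
- split=> x /weylP[p ->] _; rewrite pairing_root -!/(coord _ _) => cle;
    apply: polytope_tilde_put => // S /=; rewrite !low /= !minElt;
    have [[? ? ? ?] [? ? ? ?]] := supp_put_bounds mu p S.
  + have [-> -> -> ->] := sigma1_coord S c (mu (permW p)).
    by split; split; repeat case: ifPn; rewrite -?leNgt; lra.
  + rewrite lo_idx_omega // in cle.
    have [-> -> -> ->] := sigma2_coord S c (mu (permW p)).
    by split; split; repeat case: ifPn; rewrite -?leNgt; lra.
- move=> x [/WomegaP[p -> sp] _]; rewrite pairing_root -!/(coord _ _) => cle.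
  have := coord_sym sp => /= ceq.
  apply: polytope_tilde_put => // S /=; rewrite !low /= !minElt.
  have [-> -> -> ->] := sigma1_coord S c (sigma i2 c (sigma i1 c (mu (permW p)))).
  have [-> -> -> ->] := sigma2_coord S c (sigma i1 c (mu (permW p))).
  have [-> -> -> ->] := sigma1_coord S c (mu (permW p)).
  have [[? ? ? ?] [? ? ? ?]] := supp_put_bounds mu p S.
  by split; split; repeat case: ifPn; rewrite -?leNgt; lra.
Qed.

End Conditions.
End LoweredPolytope.

(** * Minimality *)

Section Minimality.
Context (R : realType) (n : nat) (j : 'I_n) (hj : j.+1 = n).
Local Notation l := (n + n)%N.
Implicit Types (p : 'S_l.+1) (i : 'I_l) (S : {set 'I_l.+1}) (u v w : bool).

Local Notation A := (cartanA l).
Local Notation permW := (@permW R l).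
Local Notation wt := (@wt R l).
Local Notation supp := (@supp R l).
Local Notation i1 := (idx j).
Local Notation i2 := (idx_omega j).
Local Notation ka := (lo i1).
Local Notation kb := (hi i1).
Local Notation kc := (hi i2).
Local Notation put := (put j).

Context (mu mu' : 'M[R]_l -> 'cV[R]_l).
Context (V : isV A mu) (V' : isV A mu').
Context (Vomega : isVomega mu).
Let c := lowering_const i1 (supp mu).
Context (low : forall S u v w,
  supp mu' (put S u v w) = omega_lowered j c (supp mu) S u v w).

Lemma swap13_put S u v w :
  [set k | tperm ka kc k \in put S u v w]%SET = put S w v u.
Proof.
have [ab ac bc] := letter_neq hj; apply/finset.setP => k; rewrite !inE.
by case: tpermP => [->|->|/eqP/negbTE-> /eqP/negbTE->] //; rewrite !eqxx // ![kc == _]eq_sym ac bc.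
Qed.

(** The pattern of the segment is a or ab; among the patterns of [seg_letters] these
    are the ones at which lowering changes the support function.  Each term of the minimum is bounded separately, by
    [below] applied to a point that the conditions place in the polytope. *)
Lemma supp_le_minimal mu'' p i S v : isV A mu'' -> conditions j mu c mu'' ->
  centrally_symmetric p -> seg p i = put S true v false ->
  supp mu'' (seg p i) <= supp mu' (seg p i).
Proof.
move=> V'' [_ _ c3 [c4 c4'] c5] sp eS.
have below x : polytope_tilde mu'' x -> supp mu'' (seg p i) <= pairing (wt (seg p i)) x.
  by move/(polytope_tildeP _ V''); apply.
have [lab lbc lac] := ltn_letters hj; have [_ nac _] := letter_neq hj.
have [aS vS cS] := in_put hj S true v false; rewrite -eS in aS vS cS.
have pac : (p ka < p kc)%N by move: aS cS; rewrite !inE; lia.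
have le0 : supp mu'' (seg p i) <= supp mu (seg p i).
  rewrite [leRHS]supp_seg //; apply/below/c3; split; first by apply/WomegaP; exists p.
  by rewrite refl_omega_permW // -permWM; apply: shorter_tperm.
have sq := sym_tperm hj sp; set q := (tperm ka kc * p)%g in sq.
have : c <= pairing (Defs.root R A i1) (mu (permW q)) ->
    supp mu'' (seg p i) <= pairing (wt (seg p i))
      (sigma i1 c (sigma i2 c (sigma i1 c (mu (permW q))))).
  by move=> h; apply/below/c5 => //; apply/Womega_minusP; rewrite // !permM tpermL tpermR.
rewrite pairing_root -!/(coord _ _) => le_refl.
have symq := coord_sym hj Vomega sq; rewrite /= in symq.
have := supp_seg q i V; rewrite seg_tperm eS swap13_put pairing_put // => supp_q.
have [[? ? ? ?] [? ? ? ?]] := supp_put_bounds hj mu q S.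
(* if (v) does not apply at q, then the vertex mu_q itself gives M_S < M_S' + 2c,
   where S' is the segment of q *)
have {le_refl supp_q} le2 : supp mu'' (put S true v false) <= supp mu (put S false v true) + 2 * c.
  case: (leP c (coord ka (mu (permW q)) - coord kb (mu (permW q)))) => h.
    have := le_refl h; rewrite eS pairing_put //.
    have [-> -> -> ->] := sigma1_coord hj S c (sigma i2 c (sigma i1 c (mu (permW q)))).
    have [-> -> -> ->] := sigma2_coord hj S c (sigma i1 c (mu (permW q))).
    have [-> -> -> ->] := sigma1_coord hj S c (mu (permW q)).
    by rewrite supp_q /=; lra.
  rewrite eS in le0; apply: le_trans le0 _; rewrite supp_q.
  by case: (v); rewrite /=; lra.
rewrite eS in le0 below *; rewrite low; case: v vS eS le0 le2 below => vS eS le0 le2 below;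
  rewrite /= !le_min le0 le2 andbT /=.
- pose t := (tperm kb kc * p)%g.
  (* likewise, the vertex mu_t bounds M_S when (iv) does not apply at t *)
  have tS : seg t i = put S true false true.
    by rewrite seg_tperm eS -(swap2_put hj S true true false) /swap /swp (lo_idx_omega hj).
  have := supp_seg t i V; rewrite tS pairing_put // => supp_t.
  have [[? ? ? ?] [? ? ? ?]] := supp_put_bounds hj mu t S.
  have [h|h] := leP c (coord kb (mu (permW t)) - coord kc (mu (permW t))); last first.
    by apply: le_trans le0 _; rewrite supp_t /=; lra.
  have := below (sigma i2 c (mu (permW t))); rewrite pairing_put //.
  have [-> -> -> ->] := sigma2_coord hj S c (mu (permW t)); rewrite supp_t /= => le1.
  apply: le_trans (le1 _) _; last by lra.
  apply: c4'; [exact: weyl_permW| |by rewrite pairing_root lo_idx_omega].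
  rewrite refl_permW -permWM /swp lo_idx_omega //; apply: shorter_tpermK => //.
  move: vS cS; rewrite !inE => le_b /negbT; rewrite -ltnNge; exact: leq_ltn_trans.
- pose t := (tperm ka kb * p)%g.
  have tS : seg t i = put S false true false.
    by rewrite seg_tperm eS -(swap1_put hj S true false false) /swap /swp.
  have := supp_seg t i V; rewrite tS pairing_put // => supp_t.
  have [[? ? ? ?] [? ? ? ?]] := supp_put_bounds hj mu t S.
  have [h|h] := leP c (coord ka (mu (permW t)) - coord kb (mu (permW t))); last first.
    by apply: le_trans le0 _; rewrite supp_t /=; lra.
  have := below (sigma i1 c (mu (permW t))); rewrite pairing_put //.
  have [-> -> -> ->] := sigma1_coord hj S c (mu (permW t)); rewrite supp_t /= => le1.
  apply: le_trans (le1 _) _; last by lra.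
  apply: c4; [exact: weyl_permW| |by rewrite pairing_root].
  rewrite refl_permW -permWM /swp; apply: shorter_tpermK => //.
  move: vS aS; rewrite !inE => /negbT; rewrite -ltnNge => lt_b le_a; exact: leq_ltn_trans lt_b.
Qed.

(** On segments not of the pattern a or ab both support functions agree with that
    of the original polytope, by condition (i). *)
Lemma lowered_minimal mu'' : isVomega mu'' -> conditions j mu c mu'' ->
  forall h, polytope_tilde mu' h -> polytope_tilde mu'' h.
Proof.
move=> [V'' _] cond h.
move/(polytope_tildeP _ V') => H; apply/polytope_tildeP => // p i sp.
apply: le_trans (H _ _ sp) => {h H}.
have [h1 h2] := seg_letters hj i sp.
have eS := put_id j (seg p i).
have [/andP[aS cS]|acS] := boolP ((ka \in seg p i) && (kc \notin seg p i)).
  by rewrite aS (negbTE cS) in eS; apply: supp_le_minimal V'' cond sp (esym eS).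
have [c1 _ _ _ _] := cond.
rewrite (supp_Womega_minus hj V V'' c1 sp acS) -eS low; move: h1 h2 acS.
case: (ka \in _); case: (kb \in _); case: (kc \in _) => //= h1 h2 _.
  by have := h2 isT isT.
by have := h1 isT.
Qed.

End Minimality.

Unset Implicit Arguments.
Set Strict Implicit.

Local Open Scope classical_set_scope.
Local Open Scope ring_scope.

Theorem theorem3p2p5 (R : realType) (n : nat) (j : 'I_n)
    (Phat : set 'cV[R]_n) (P P' : set 'cV[R]_(n + n))
    (mu mu' : 'M[R]_(n + n) -> 'cV[R]_(n + n))
    (hn : (2 <= n)%N) (hj : j.+1 = n)
    (hPhat : isMV (cartanB n) Phat)
    (hP : isMVomega P) (hPhi : Phi P Phat)
    (hmu : ggms (cartanA (n + n)) P mu)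
    (hP' : lowering_omega j P P')
    (hmu' : ggms (cartanA (n + n)) P' mu') :
  let c := Mdata mu 1%:M (idx j)
           - Mdata mu (refl R (cartanA (n + n)) (idx j)) (idx j) - 1 in
  [/\ isVomega mu', conditions j mu c mu' &
      forall mu'', isVomega mu'' -> conditions j mu c mu'' ->
        polytope_tilde mu' `<=` polytope_tilde mu''].
Proof.
have V := hmu.1; have V' := hmu'.1.
have [sym mu'1 low] := lowering_omega_supp hj hP hmu hP' hmu'.
have Vomega := supp_isVomega V sym.
have -> : Mdata mu 1%:M (idx j) - Mdata mu (refl R (cartanA (n + n)) (idx j)) (idx j) - 1
    = lowering_const (idx j) (supp mu).
  by rewrite refl_permW -permW1 !Mdata_supp // seg1 seg_swp.
split; first exact: isVomega_lowered Vomega low.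
  exact: lowered_conditions.
by move=> mu'' V'' cond h; apply: lowered_minimal cond h.
Qed.
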